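(* Let $p(\cdot)\in\mathcal P^{\log}_\pm(\mathbb B)$. Then $B_{p(\cdot)}=B^+_{p(\cdot)}=B^{++}_{p(\cdot)}$ (as classes of weights not a.e. zero).
   Context: $\mathbb B$ unit ball of $\mathbb C^n$, $\alpha>0$, $d\mu_\alpha(z)=(1-|z|^2)^{\alpha-1}d\mu(z)$. Pseudo-distance $d(z,\zeta)=\big||z|-|\zeta|\big|+\big|1-\frac{\langle z,\zeta\rangle}{|z||\zeta|}\big|$ ($z,\zeta\ne0$), $d(z,\zeta)=|z|+|\zeta|$ otherwise; pseudo-balls $B(z,r)=\{\zeta:d(z,\zeta)<r\}$; $\mathcal B$ = pseudo-balls $B(z,r)$ with $r>1-|z|$. $\mathcal P^{\log}_\pm(\mathbb B)$: measurable $p$ with $\operatorname{ess\,inf}p>1$ and $|p(z)-p(\zeta)|\le c/\ln(e+1/d(z,\zeta))$ for some $c$ and all $z\ne\zeta$; $1/p+1/p'=1$. For an exponent $r(\cdot)$ bounded and bounded away from $0$: $\|f\|_{r(\cdot)}=\inf\{\lambda>0:\int|f/\lambda|^{r(z)}d\mu_\alpha\le1\}$. Weights are non-negative locally integrable functions; $w(E)=\int_Ew\,d\mu_\alpha$; $w'=w^{1-p'(\cdot)}$; $p_B=\big(\frac1{\mu_\alpha(B)}\int_B\frac1pd\mu_\alpha\big)^{-1}$. $w\in B_{p(\cdot)}$: $\sup_{B\in\mathcal B}\frac1{\mu_\alpha(B)}\|w^{1/p(\cdot)}\chi_B\|_{p(\cdot)}\|w^{-1/p(\cdot)}\chi_B\|_{p'(\cdot)}<\infty$.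 $w\in B^+_{p(\cdot)}$: $\sup_{B\in\mathcal B}\mu_\alpha(B)^{-p_B}w(B)\|w^{-1}\chi_B\|_{p'(\cdot)/p(\cdot)}<\infty$. $w\in B^{++}_{p(\cdot)}$: $\sup_{B\in\mathcal B}\frac{w(B)}{\mu_\alpha(B)}\big(\frac{w'(B)}{\mu_\alpha(B)}\big)^{p_B-1}<\infty$. *)

(* Defs.v *)
From HB Require Import structures.
From mathcomp Require Import all_boot all_order all_algebra.
From mathcomp Require Import all_classical all_reals all_analysis ess_sup_inf.
Set Implicit Arguments. Unset Strict Implicit. Unset Printing Implicit Defensive.
Import Order.TTheory GRing.Theory Num.Theory.
Import numFieldNormedType.Exports.
Local Open Scope classical_set_scope.
Local Open Scope ring_scope.

(* Points of C^n are n-tuples of pairs (Re z_j, Im z_j). *)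
Notation Cn R n := (n.-tuple (R * R))%type.

Section Ball.
Variables (R : realType) (n : nat).
Local Notation T := (Cn R n).

Definition normC (z : T) : R :=
  Num.sqrt (\sum_(j < n) ((tnth z j).1 ^+ 2 + (tnth z j).2 ^+ 2)).

(* real and imaginary parts of <z, w> = sum_j z_j * conj(w_j) *)
Definition reInner (z w : T) : R :=
  \sum_(j < n) ((tnth z j).1 * (tnth w j).1 + (tnth z j).2 * (tnth w j).2).
Definition imInner (z w : T) : R :=
  \sum_(j < n) ((tnth z j).2 * (tnth w j).1 - (tnth z j).1 * (tnth w j).2).

Definition pdist (z w : T) : R :=
  if (normC z != 0) && (normC w != 0) then
    let q := normC z * normC w in
    `|normC z - normC w| +
      Num.sqrt ((1 - reInner z w / q) ^+ 2 + (imInner z w / q) ^+ 2)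
  else normC z + normC w.

Definition Ball : set T := [set z | normC z < 1].

Definition pball (z : T) (r : R) : set T := [set w | Ball w /\ pdist z w < r].

Definition Bfam (B : set T) : Prop :=
  exists z r, Ball z /\ 1 - normC z < r /\ B = pball z r.

Definition box (a b : 'I_n -> R * R) : set T :=
  [set z | forall j, ((a j).1 <= (tnth z j).1 <= (b j).1) /\
                     ((a j).2 <= (tnth z j).2 <= (b j).2)].

Definition is_normalized_volume (mu : set T -> \bar R) : Prop :=
  (exists c : R, 0 < c /\
    forall a b : 'I_n -> R * R,
      (forall j, (a j).1 <= (b j).1 /\ (a j).2 <= (b j).2) ->
      mu (box a b) = (c * \prod_(j < n)
                        (((b j).1 - (a j).1) * ((b j).2 - (a j).2)))%:E)
  /\ mu Ball = 1%E.

End Ball.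

Section Weights.
Variables (R : realType) (n : nat).
Local Notation T := (Cn R n).
Variable mu : {measure set T -> \bar R}.
Variable alpha : R.
Local Open Scope ereal_scope.

Definition dens (z : T) : R := (1 - normC z ^+ 2) `^ (alpha - 1).

Definition intA (E : set T) (g : T -> \bar R) : \bar R :=
  \int[mu]_(z in E) (g z * (dens z)%:E).

Definition muA (E : set T) : \bar R := intA E (fun=> 1).

(* variable exponent norm on (Ball, mu_alpha); inf of the empty set is +oo *)
Definition vnorm (r : T -> R) (f : T -> \bar R) : \bar R :=
  ereal_inf [set l%:E | l in [set l : R | (0 < l)%R /\
     intA (@Ball R n) (fun z => (`|f z| * (l^-1)%:E) `^ r z) <= 1]].

Definition chi (E : set T) (f : T -> \bar R) : T -> \bar R :=
  fun z => if `[< E z >] then f z else 0.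

(* x^(-s) for x >= 0, s > 0, with 0^(-s) = +oo *)
Definition npow (x s : R) : \bar R := if x == 0%R then +oo else (x `^ (- s))%:E.

Variable p : T -> R.

Definition pconj (z : T) : R := p z / (p z - 1).

Definition pB (B : set T) : R :=
  ((fine (muA B))^-1 * fine (intA B (fun z => ((p z)^-1)%:E)))^-1.

Definition is_weight (w : T -> R) : Prop :=
  (forall z, @Ball R n z -> (0 <= w z)%R) /\ measurable_fun (@Ball R n) w /\
  forall r : R, (0 < r < 1)%R ->
    intA [set z | (normC z <= r)%R] (fun z => (w z)%:E) < +oo.

Definition ae_zero (w : T -> R) : Prop :=
  {ae mu, forall z, @Ball R n z -> w z = 0%R}.

Definition in_B (w : T -> R) : Prop :=
  exists M : R, forall B, Bfam B ->
    ((fine (muA B))^-1)%:E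
      * vnorm p (chi B (fun z => (w z `^ (p z)^-1)%:E))
      * vnorm pconj (chi B (fun z => npow (w z) (p z)^-1)) <= M%:E.

Definition in_Bplus (w : T -> R) : Prop :=
  exists M : R, forall B, Bfam B ->
    ((fine (muA B)) `^ (- pB B))%:E * intA B (fun z => (w z)%:E)
      * vnorm (fun z => (pconj z / p z)%R) (chi B (fun z => npow (w z) 1)) <= M%:E.

Definition in_Bplusplus (w : T -> R) : Prop :=
  exists M : R, forall B, Bfam B ->
    intA B (fun z => (w z)%:E) * ((fine (muA B))^-1)%:E
      * ((intA B (fun z => npow (w z) (pconj z - 1)%R) * ((fine (muA B))^-1)%:E)
           `^ (pB B - 1)%R) <= M%:E.

End Weights.

Definition Plog (R : realType) (n : nat) (mu : {measure set Cn R n -> \bar R})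
    (p : Cn R n -> R) : Prop :=
  measurable_fun (@Ball R n) p /\
  (1 < ess_inf mu (fun z => if `[< @Ball R n z >] then (p z)%:E else +oo%E))%E /\
  exists c : R, forall z w, @Ball R n z -> @Ball R n w -> z <> w ->
    `|p z - p w| <= c / ln (expR 1 + (pdist z w)^-1).

(* Main.v *)
Require Import Defs.
From HB Require Import structures.
From mathcomp Require Import all_boot all_order all_algebra.
From mathcomp Require Import all_classical all_reals all_analysis.
From mathcomp Require Import measurable_realfun ess_sup_inf.
From mathcomp Require Import ring lra.
Set Implicit Arguments. Unset Strict Implicit. Unset Printing Implicit Defensive.
Import Order.TTheory GRing.Theory Num.Theory.
Import numFieldNormedType.Exports.
Local Open Scope classical_set_scope.
Local Open Scope ring_scope.

(** For a pseudo-ball [B] touching the boundary put [m = mu_alpha(B)],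
    [a = w(B)], [b = w'(B)] and [q = p_B].  Such a [B] of radius [r] has
    [m >= c min(r,1)^N] and diameter at most [8 min(r,1)], so the log-Hoelder
    condition bounds [|p(z) - q| (1 + |ln m|)] on [B] uniformly.  Each of the
    three conditions, tested on [B] = the whole ball, makes [w] and [w']
    integrable; integrating [1 <= t^p w + t^(-p') w'] then bounds [a] and [b]
    below by powers of [m], so [|p(z) - q|] times [|ln a|] or [|ln b|] is bounded
    as well.  Hence [a^(p(z)/q)] is comparable to [a], the modular defining the
    norm becomes that of a constant exponent, and the three norms are comparable
    to [a^(1/q)], [b^(1-1/q)] and [b^(q-1)].  The [B] quantity is therefore
    comparable to [((a/m) (b/m)^(q-1))^(1/q)] and the other two to
    [(a/m) (b/m)^(q-1)]. *)

(** * Measurability *)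

(** Weights are only locally integrable, and the masses and norms are extended reals in which 0
    times +oo is 0, so a bounded product says nothing about its factors until they are known to be
    positive. Hence the order of the argument on the whole ball: positivity of the masses of w and
    w' (this is what excludes weights that vanish almost everywhere), then finiteness, and only then
    logarithms. Once every quantity is written as an exponential, comparability is a bounded
    difference of exponents, and replacing p(z) by q costs an additive term |p(z) - q| |ln a|.
    Log-Hoelder continuity controls |p(z) - q| only against |ln m|, which is why a and b must be
    tied to powers of m. The measure is known only through its values on boxes and on the unit ball.
    Uniqueness of measures on the pi-system of boxes gives its behaviour under dilations, hence the
    exact volume of every centred ball; the volumes of thin shells then show that mu_alpha is finite
    although its density blows up at the sphere when alpha < 1. *)

Section Measurability.
Context d (T : measurableType d) (R : realType).
Implicit Types (D : set T) (f g : T -> R).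

Lemma measurable_fun_sqrt D f : measurable_fun D f ->
  measurable_fun D (fun x => Num.sqrt (f x)).
Proof.
(* The truncation at 0 matters: [Num.sqrt] vanishes on negative numbers, [powR] does not. *)
move=> mf; rewrite (_ : (fun x => _) = (fun x => powR (Num.max (f x) 0) 2^-1)).
  have m1 := measurable_maxr mf (measurable_cst (0 : R)).
  exact: (measurableT_comp (measurable_powR (2^-1 : R)) m1).
apply/funext => x; rewrite powR12_sqrt ?le_max ?lexx ?orbT//.
case: (ltP (f x) 0) => // f0.
by rewrite sqrtr0 ler0_sqrtr// ltW.
Qed.

Lemma measurable_fun_inv D f : measurable_fun D f ->
  measurable_fun D (fun x => (f x)^-1).
Proof.
(* Squaring makes the base of [powR] non-negative; at 0 both sides are 0. *)
move=> mf; rewrite (_ : (fun x => _) = (fun x => f x * powR (f x ^+ 2) (-1))).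
  apply: measurable_funM => //.
  exact: (measurableT_comp (measurable_powR (-1 : R)) (measurable_funX 2 mf)).
apply/funext => x; rewrite powR_inv1 ?sqr_ge0//.
have [->|f0] := eqVneq (f x) 0; first by rewrite invr0 mul0r.
by field.
Qed.

Lemma measurable_fun_powR2 D f g : measurable D ->
  measurable_fun D f -> measurable_fun D g ->
  measurable_fun D (fun x => f x `^ g x).
Proof.
move=> mD mf mg; rewrite /powR.
have m0 h : measurable_fun D h -> measurable_fun D (fun x => h x == 0 :> R).
  by move=> mh; exact: measurable_fun_eqr.
apply: measurable_fun_if => //; first exact: m0.
- rewrite [X in measurable_fun _ X](_ : _ = (fun x => if g x == 0 then 1 else 0)).
    apply: measurable_fun_if => //; first exact: (m0 _ mf mD).
    by apply: measurable_funS (m0 _ mg) => //; exact: subIsetl.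
  by apply/funext => x; case: eqP.
- apply: measurable_funS mD _ _; first exact: subIsetl.
  apply: measurableT_comp => //; apply: measurable_funM => //.
  exact: measurableT_comp (@measurable_ln R) mf.
Qed.

End Measurability.

Section Volume.
Variables (R : realType) (n : nat).
Local Notation T := (Cn R n).

Lemma measurable_re (i : 'I_n) D : measurable_fun D (fun z : T => (tnth z i).1).
Proof.
apply: measurable_funTS.
exact: (measurableT_comp measurable_fst (@measurable_tnth _ (R * R)%type n i)).
Qed.

Lemma measurable_im (i : 'I_n) D : measurable_fun D (fun z : T => (tnth z i).2).
Proof.
apply: measurable_funTS.
exact: (measurableT_comp measurable_snd (@measurable_tnth _ (R * R)%type n i)).
Qed.

Lemma measurable_normC D : measurable_fun D (@normC R n).
Proof.
apply: measurable_fun_sqrt; apply: measurable_sum => i.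
by apply: measurable_funD; apply: measurable_funX;
  [exact: measurable_re|exact: measurable_im].
Qed.

Lemma measurable_pdist z D : measurable_fun D (@pdist R n z).
Proof.
have mD : measurable_fun [set: T] (@pdist R n z); last exact: measurable_funTS.
have mN : measurable_fun [set: T] (@normC R n) by exact: measurable_normC.
have mre : measurable_fun [set: T] (@reInner R n z).
  by apply: measurable_sum => i; apply: measurable_funD;
    apply: measurable_funM => //; [exact: measurable_re|exact: measurable_im].
have mim : measurable_fun [set: T] (@imInner R n z).
  by apply: measurable_sum => i; apply: measurable_funB;
    apply: measurable_funM => //; [exact: measurable_re|exact: measurable_im].
have mq : measurable_fun [set: T] (fun w : T => (normC z * normC w)^-1).
  by apply: measurable_fun_inv; exact: measurable_funM.
apply: measurable_fun_ifT => //.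
- apply: measurable_and => //.
  by apply: measurable_neg; exact: measurable_fun_eqr.
- apply: measurable_funD.
    by apply: measurableT_comp => //; exact: measurable_funB.
  apply: measurable_fun_sqrt; apply: measurable_funD; apply: measurable_funX.
    by apply: measurable_funB => //; exact: measurable_funM.
  exact: measurable_funM.
- exact: measurable_funD.
Qed.

Lemma measurable_normC_lt r : measurable [set z : T | normC z < r].
Proof.
rewrite -[X in measurable X]setTI.
exact: (measurable_fun_ltr (@measurable_normC setT) (measurable_cst r)
          measurableT (Y := [set true])).
Qed.

Lemma measurable_Ball : measurable (@Ball R n).
Proof. exact: measurable_normC_lt. Qed.

Lemma measurable_pball z r : measurable (@pball R n z r).
Proof.
apply: measurableI; first exact: measurable_Ball.
rewrite -[X in measurable X]setTI.
exact: (measurable_fun_ltr (@measurable_pdist z setT) (measurable_cst r)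
          measurableT (Y := [set true])).
Qed.

Definition boxes : set (set T) := [set A | exists a b, A = box a b].

Lemma measurable_box (a b : 'I_n -> R * R) : measurable (box a b).
Proof.
rewrite (_ : box a b = \bigcap_(j in [set: 'I_n])
   [set z : T | (a j).1 <= (tnth z j).1 <= (b j).1 /\
                (a j).2 <= (tnth z j).2 <= (b j).2]); last first.
  by apply/seteqP; split => [z H i /= _|z H j]; apply: H.
have mI (f : T -> R) (x y : R) : measurable_fun setT f ->
    measurable [set z | x <= f z <= y].
  move=> mf; have := mf measurableT `[x, y]%classic.
  by rewrite setTI => /(_ (measurable_itv _)); rewrite set_itvcc.
apply: fin_bigcap_measurable => // j _; apply: measurableI.
  by apply: (mI (fun z => (tnth z j).1)); exact: measurable_re.
by apply: (mI (fun z => (tnth z j).2)); exact: measurable_im.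
Qed.

End Volume.

(** * Volumes of balls and shells *)

Section Volume.
Variables (R : realType) (n : nat).
Local Notation T := (Cn R n).

Lemma box_setI_closed : setI_closed (@boxes R n).
Proof.
move=> _ _ [a [b ->]] [a' [b' ->]].
exists (fun j => (Num.max (a j).1 (a' j).1, Num.max (a j).2 (a' j).2)),
       (fun j => (Num.min (b j).1 (b' j).1, Num.min (b j).2 (b' j).2)).
apply/seteqP; split => z /=.
  move=> [H H'] j; rewrite !ge_max !le_min.
  have [/andP[-> ->] /andP[-> ->]] := H j.
  by have [/andP[-> ->] /andP[-> ->]] := H' j.
move=> H; split => j; have [] := H j; rewrite !ge_max !le_min;
  by move=> /andP[/andP[? ?] /andP[? ?]] /andP[/andP[? ?] /andP[? ?]]; split; apply/andP.
Qed.

Definition cube (k : nat) : set T :=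
  box (fun=> (- k%:R, - k%:R)) (fun=> (k%:R, k%:R)).

Lemma cube_ev (z : T) : exists k : nat, forall i,
  `|(tnth z i).1| <= k%:R /\ `|(tnth z i).2| <= k%:R.
Proof.
exists (Num.truncn (\sum_i (`|(tnth z i).1| + `|(tnth z i).2|))).+1 => i.
have /ltW h : \sum_i (`|(tnth z i).1| + `|(tnth z i).2|) <
    (Num.truncn (\sum_i (`|(tnth z i).1| + `|(tnth z i).2|))).+1%:R.
  by apply: truncnS_gt.
have h0 : `|(tnth z i).1| + `|(tnth z i).2| <= \sum_i (`|(tnth z i).1| + `|(tnth z i).2|).
  by rewrite (bigD1 i)//= lerDl sumr_ge0// => j _; rewrite addr_ge0.
split; apply: le_trans h; apply: le_trans h0; by rewrite ?lerDl ?lerDr.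
Qed.

Lemma bigcup_cube : \bigcup_k cube k = setT.
Proof.
apply/seteqP; split => // z _; have [k hk] := cube_ev z.
by exists k => // j; have := hk j; rewrite !ler_norml.
Qed.

(** A half-space is the union over k of the boxes with one face held at x and all other faces at
    distance k; [b] selects the real or the imaginary part. *)
Lemma halfspace_boxes (b : bool) (i : 'I_n) (x : R) :
  <<s @boxes R n >>
    [set z : T | x <= if b then (tnth z i).1 else (tnth z i).2].
Proof.
rewrite (_ : [set z : T | _] = \bigcup_k box
   (fun j => (if (j == i) && b then x else - k%:R,
              if (j == i) && ~~ b then x else - k%:R))
   (fun=> (k%:R, k%:R))); last first.
  apply/seteqP; split => z /=.
    move=> xz; have [k hk] := cube_ev z; exists k => // j.
    have := hk j; rewrite !ler_norml => -[/andP[h1 h2] /andP[h3 h4]].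
    case: (eqVneq j i) => [jE|_]; last by split; apply/andP.
    by subst j; case: b xz => /= xz; split; apply/andP.
  move=> [k _ /(_ i)]; rewrite eqxx; case: b => /=;
    by move=> [/andP[? ?] /andP[? ?]].
apply: sigma_algebra_bigcup => k.
by apply: sub_sigma_algebra; do 2 eexists.
Qed.

(** The identity from the sigma-algebra generated by boxes to the product one is measurable because
    each real coordinate is, and for a coordinate it suffices to test closed half-lines. *)
Lemma measurable_sub_boxes : @measurable _ T `<=` <<s @boxes R n >>.
Proof.
pose GT : measurableType _ := g_sigma_algebraType (@boxes R n).
have mhalf (b : bool) (i : 'I_n) : measurable_fun [set: GT]
    (fun z : GT => if b then (tnth (z : T) i).1 else (tnth (z : T) i).2).
  apply: (measurability (@RGenCInfty.G R)).
    exact: RGenCInfty.measurableE.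
  move=> _ [_ [x ->] <-]; rewrite setTI.
  rewrite (_ : _ @^-1` _ =
      [set z : T | x <= if b then (tnth z i).1 else (tnth z i).2]).
    exact: halfspace_boxes.
  by apply/seteqP; split => z /=; rewrite in_itv/= andbT.
suff mid : measurable_fun [set: GT] (fun z : GT => z : T).
  by move=> A mA; have := mid measurableT A mA; rewrite setTI.
apply/measurable_fun_tnthP => i.
rewrite (_ : _ \o _ = fun z : GT => ((tnth (z : T) i).1, (tnth (z : T) i).2)).
  by apply: measurable_fun_pair; [exact: (mhalf true)|exact: (mhalf false)].
by apply/funext => z /=; rewrite -surjective_pairing.
Qed.

Definition scale_tuple (t : R) (z : T) : T :=
  [tuple (t * (tnth z i).1, t * (tnth z i).2) | i < n].

Lemma measurable_scale_tuple t : measurable_fun setT (scale_tuple t).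
Proof.
apply/measurable_fun_tnthP => i.
rewrite (_ : _ \o _ = fun z : T => (t * (tnth z i).1, t * (tnth z i).2)).
  by apply: measurable_fun_pair; apply: measurable_funM => //;
   [exact: measurable_re|exact: measurable_im].
by apply/funext => z /=; rewrite tnth_mktuple.
Qed.

Lemma normC_scale t z : 0 <= t -> normC (scale_tuple t z) = t * normC z.
Proof.
move=> t0; rewrite /normC -[X in X * _](ger0_norm t0) -sqrtr_sqr.
rewrite -sqrtrM ?sqr_ge0//; congr Num.sqrt.
rewrite mulr_sumr; apply: eq_bigr => i _; rewrite tnth_mktuple/=.
by rewrite !exprMn mulrDr.
Qed.

End Volume.

Section NormalizedVolume.
Variables (R : realType) (n : nat).
Local Notation T := (Cn R n).
Variable mu : {measure set T -> \bar R}.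
Hypothesis hmu : is_normalized_volume mu.

Lemma scale_preimage_box t (a b : 'I_n -> R * R) : 0 < t ->
  scale_tuple t @^-1` (box a b) =
  box (fun j => (t^-1 * (a j).1, t^-1 * (a j).2))
      (fun j => (t^-1 * (b j).1, t^-1 * (b j).2)).
Proof.
move=> t0; apply/seteqP; split => z /= H j; have := H j;
  by rewrite tnth_mktuple/= !ler_pdivrMl// !ler_pdivlMl.
Qed.

Lemma volume_scale_box t (a b : 'I_n -> R * R) : 0 < t ->
  mu (scale_tuple t @^-1` (box a b)) = ((t^-1 ^+ (n.*2))%:E * mu (box a b))%E.
Proof.
move=> t0; rewrite scale_preimage_box//.
have [c [c0 hbox]] := hmu.1.
have [ab|/existsNP[j hj]] := pselect (forall j, (a j).1 <= (b j).1 /\ (a j).2 <= (b j).2).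
  rewrite !hbox//; last first.
    by move=> j /=; rewrite !ler_pM2l ?invr_gt0//; exact: ab.
  rewrite -EFinM; congr EFin; rewrite mulrCA; congr (_ * _) => /=.
  rewrite -muln2 mulnC exprM.
  rewrite (_ : t^-1 ^+ 2 ^+ n = \prod_(j < n) (t^-1 ^+ 2)); last first.
    by rewrite prodr_const card_ord.
  rewrite -big_split/=.
  by apply: eq_bigr => j _; ring.
(* With a reversed side the box formula does not apply, but both boxes are empty; the case t' = 1 is
   the box itself. *)
have h0 t' : 0 < t' -> box (fun j => (t' * (a j).1, t' * (a j).2))
                (fun j => (t' * (b j).1, t' * (b j).2)) = set0.
  move=> t'0; apply/seteqP; split => // z /= /(_ j)[/andP[h1 h2] /andP[h3 h4]].
  apply: hj; have := le_trans h1 h2; have := le_trans h3 h4.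
  by rewrite !ler_pM2l// => -> ->.
have h1 := h0 1 ltr01.
rewrite h0 ?invr_gt0// (_ : box a b = set0) ?measure0 ?mule0//.
rewrite -h1; congr box; apply/funext => i; rewrite !mul1r;
  by case: (_ i).
Qed.

(** Both sides are measures in A, a pushforward and a multiple of [mu]; they agree on boxes, which
    form a generating pi-system exhausted by the cubes of finite measure. *)
Lemma volume_scale (t : R) (A : set T) : 0 < t -> measurable A ->
  mu (scale_tuple t @^-1` A) = ((t^-1 ^+ (n.*2))%:E * mu A)%E.
Proof.
move=> t0 mA.
have k0 : 0 <= t^-1 ^+ n.*2 by rewrite exprn_ge0// invr_ge0 ltW.
pose m1 : {measure set T -> \bar R} :=
  measure_function_pushforward__canonical__measure_function_Measure mu
    (measurable_scale_tuple (n := n) t).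
pose m2 : {measure set T -> \bar R} := mscale (NngNum k0) mu.
have gen := @g_sigma_algebra_measure_unique _ R T (@boxes R n) _ (@cube R n).
suff : m1 A = m2 A by [].
apply: gen.
- by move=> _ [a [b ->]]; exact: measurable_box.
- by move=> k; do 2 eexists.
- exact: bigcup_cube.
- exact: box_setI_closed.
- by move=> _ [a [b ->]]; exact: volume_scale_box.
- move=> k; rewrite /m1/= /pushforward volume_scale_box//.
  have [c [c0 hbox]] := hmu.1.
  rewrite hbox ?ltry// => j /=.
  by rewrite -subr_ge0 opprK addr_ge0.
- exact: measurable_sub_boxes.
Qed.

(** The ball is the preimage of the unit ball under dilation by 1/s, so the normalization
    [mu Ball = 1] gives the exact value without computing the constant of the box formula. *)
Lemma volume_ball (s : R) : 0 < s -> mu [set z : T | normC z < s] = (s ^+ n.*2)%:E.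
Proof.
move=> s0; have t0 : 0 < s^-1 by rewrite invr_gt0.
have := volume_scale t0 (@measurable_Ball R n).
rewrite hmu.2 mule1 invrK => <-; congr (mu _); apply/seteqP.
by split => z /=; rewrite /Ball/= normC_scale ?(ltW t0)// ltr_pdivrMl// mulr1.
Qed.

Lemma volume_shell (s t : R) : 0 < s -> s < t -> t <= 1 ->
  (mu [set z : T | (s <= normC z < t)%R] <= (n.*2%:R * (t - s))%:E)%E.
Proof.
move=> s0 st t1.
have t0 : 0 < t by exact: lt_trans st.
have -> : [set z : T | s <= normC z < t] =
    [set z | normC z < t] `\` [set z | normC z < s].
  apply/seteqP; split => z /=; first by move=> /andP[h ->]; split => //; rewrite ltNge h.
  by move=> [-> /negP]; rewrite -leNgt => ->.
have -> : mu ([set z : T | normC z < t] `\` [set z | normC z < s]) =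
    (mu [set z : T | (normC z < t)%R] -
     mu ([set z : T | (normC z < t)%R] `&` [set z | (normC z < s)%R]))%E.
  apply: measureD; [exact: measurable_normC_lt|exact: measurable_normC_lt|].
  by apply: (le_lt_trans (y := (t ^+ n.*2)%:E)); rewrite ?ltry//= -volume_ball.
rewrite volume_ball//.
rewrite (_ : _ `&` _ = [set z : T | normC z < s]); last first.
  by rewrite setIidr// => z /= zs; exact: lt_trans st.
rewrite volume_ball// -EFinB lee_fin.
(* The mean value bound t^N - s^N <= N (t - s) for 0 < s < t <= 1, by induction on N. *)
elim: (n.*2) => [|k IH]; first by rewrite !expr0 subrr mul0r.
rewrite !exprS -natr1 mulrDl mul1r.
have h1 : t ^+ k <= 1 by rewrite exprn_ile1// ltW.
have h2 : s ^+ k <= t ^+ k by rewrite lerXn2r// ?nnegrE ltW.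
have h3 : 0 <= s ^+ k by rewrite exprn_ge0// ltW.
nra.
Qed.

End NormalizedVolume.

(** * The measure [mu_alpha] *)

Lemma powR_expR (R : realType) (a x : R) : 0 < a -> a `^ x = expR (x * ln a).
Proof. by move=> a0; rewrite /powR gt_eqF. Qed.

Section WeightedIntegral.
Variables (R : realType) (n : nat).
Local Notation T := (Cn R n).
Variables (mu : {measure set T -> \bar R}) (alpha : R).
Local Open Scope ereal_scope.
Implicit Types (E F : set T) (f g : T -> \bar R).

Lemma normC_ge0 (z : T) : (0 <= normC z)%R. Proof. exact: sqrtr_ge0. Qed.

Lemma measurable_dens E : measurable_fun E (@dens R n alpha).
Proof.
apply: measurable_funTS; apply: measurable_fun_powR2 => //.
by apply: measurable_funB => //; apply: measurable_funX; exact: measurable_normC.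
Qed.

Lemma dens_ge0 (z : T) : (0 <= dens alpha z)%R. Proof. exact: powR_ge0. Qed.

Lemma dens_gt0 (z : T) : Ball z -> (0 < dens alpha z)%R.
Proof. by move=> Bz; rewrite powR_gt0// subr_gt0 expr_lt1 ?normC_ge0. Qed.

Lemma measurable_muldens E f : measurable_fun E f ->
  measurable_fun E (fun z => f z * (dens alpha z)%:E).
Proof.
move=> mf; apply: emeasurable_funM => //.
by apply/measurable_EFinP; exact: measurable_dens.
Qed.

Lemma intA_ge0 E f : (forall z, E z -> 0 <= f z) -> 0 <= intA mu alpha E f.
Proof.
by move=> f0; apply: integral_ge0 => z Ez; rewrite mule_ge0 ?f0// lee_fin dens_ge0.
Qed.

Lemma le_intA E f g : measurable E -> measurable_fun E f -> measurable_fun E g ->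
  (forall z, E z -> 0 <= f z) -> (forall z, E z -> f z <= g z) ->
  intA mu alpha E f <= intA mu alpha E g.
Proof.
move=> mE mf mg f0 fg; apply: ge0_le_integral => //.
- by move=> z Ez; rewrite mule_ge0 ?f0// lee_fin dens_ge0.
- exact: measurable_muldens.
- exact: measurable_muldens.
- by move=> z Ez; rewrite lee_wpmul2r ?lee_fin ?dens_ge0// fg.
Qed.

Lemma intA_subset E F f : measurable E -> measurable F -> measurable_fun F f ->
  (forall z, F z -> 0 <= f z) -> E `<=` F -> intA mu alpha E f <= intA mu alpha F f.
Proof.
move=> mE mF mf f0 EF; apply: ge0_subset_integral => //.
- exact: measurable_muldens.
- by move=> z Ez; rewrite mule_ge0 ?f0// lee_fin dens_ge0.
Qed.

Lemma intAZl E f (k : R) : measurable E -> measurable_fun E f ->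
  (forall z, E z -> 0 <= f z) -> (0 <= k)%R ->
  intA mu alpha E (fun z => k%:E * f z) = k%:E * intA mu alpha E f.
Proof.
move=> mE mf f0 k0; rewrite /intA -ge0_integralZl_EFin//.
- by apply: eq_integral => z _; rewrite muleA.
- by move=> z Ez; rewrite mule_ge0 ?f0// lee_fin dens_ge0.
- exact: measurable_muldens.
Qed.

Lemma intAD E f g : measurable E -> measurable_fun E f -> measurable_fun E g ->
  (forall z, E z -> 0 <= f z) -> (forall z, E z -> 0 <= g z) ->
  intA mu alpha E (fun z => f z + g z) = intA mu alpha E f + intA mu alpha E g.
Proof.
move=> mE mf mg f0 g0; rewrite /intA -ge0_integralD//.
- by apply: eq_integral => z /set_mem Ez; rewrite ge0_muleDl ?f0 ?g0.
- by move=> z Ez; rewrite mule_ge0 ?f0// lee_fin dens_ge0.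
- exact: measurable_muldens.
- by move=> z Ez; rewrite mule_ge0 ?g0// lee_fin dens_ge0.
- exact: measurable_muldens.
Qed.

Lemma eq_intA E f g : (forall z, E z -> f z = g z) ->
  intA mu alpha E f = intA mu alpha E g.
Proof. by move=> fg; apply: eq_integral => z /set_mem Ez; rewrite fg. Qed.

Lemma intA_chi E F f : E `<=` F ->
  intA mu alpha F (chi E f) = intA mu alpha E f.
Proof.
move=> EF; rewrite /intA -[E in RHS](setIidr EF) integral_mkcondr.
apply: eq_integral => z _; rewrite /chi patchE.
by case: asboolP => Ez; [rewrite mem_set|rewrite memNset// mul0e].
Qed.

(** The density is strictly positive inside the ball, so it can be cancelled. *)
Lemma intA_eq0 E f : measurable E -> E `<=` @Ball R n -> measurable_fun E f ->
  (forall z, E z -> 0 <= f z) -> intA mu alpha E f = 0 ->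
  {ae mu, forall z, E z -> f z = 0}.
Proof.
move=> mE EB mf f0 I0.
have mfd := measurable_muldens mf.
have /(ae_eq_integral_abs mu mE mfd) : \int[mu]_(z in E) `|f z * (dens alpha z)%:E| = 0.
  rewrite -[RHS]I0; apply: eq_integral => z /set_mem Ez.
  by rewrite gee0_abs// mule_ge0 ?f0// lee_fin dens_ge0.
apply: filterS => z /= h Ez; have /eqP := h Ez.
rewrite mule_eq0 eqe => /orP[/eqP//|/eqP d0].
by have := dens_gt0 (EB _ Ez); rewrite d0 ltxx.
Qed.

Lemma intA_cst E (k : R) : measurable E -> (0 <= k)%R ->
  intA mu alpha E (fun=> k%:E) = k%:E * muA mu alpha E.
Proof.
by move=> mE k0; rewrite -intAZl//; apply: eq_intA => z _; rewrite mule1.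
Qed.

End WeightedIntegral.

(** * Finiteness of the total mass of mu_alpha *)

Section Finite.
Variables (R : realType) (n : nat).
Local Notation T := (Cn R n).
Variables (mu : {measure set T -> \bar R}) (alpha : R).
Hypothesis hmu : is_normalized_volume mu.
Hypothesis alpha_gt0 : 0 < alpha.

Let q : R := 2^-1.

(** Dyadic shells accumulating at the sphere: on the k-th one 1 - |z| is of order 2^(-k), and so is
    its volume. *)
Let shell (k : nat) : set T := [set z | 1 - q ^+ k <= normC z < 1 - q ^+ k.+1].

Lemma measurable_shell k : measurable (shell k).
Proof.
rewrite (_ : shell k = [set z | normC z < 1 - q ^+ k.+1] `\` [set z | normC z < 1 - q ^+ k]).
  by apply: measurableD; exact: measurable_normC_lt.
apply/seteqP; split => z /=; first by move=> /andP[h ->]; split => //; apply/negP; rewrite -leNgt.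
by move=> [h /negP]; rewrite -leNgt /shell/= h => ->.
Qed.

Lemma geometric_sum_le (r : R) N : 0 <= r -> r < 1 ->
  \sum_(0 <= k < N) r ^+ k <= (1 - r)^-1.
Proof.
move=> r0 r1; have r1' : 0 < 1 - r by rewrite subr_gt0.
suff -> : \sum_(0 <= k < N) r ^+ k = (1 - r ^+ N) / (1 - r).
  by rewrite ler_piMl ?invr_ge0 ?(ltW r1')// gerBl exprn_ge0.
elim: N => [|N IH]; first by rewrite big_nil expr0 subrr mul0r.
rewrite big_nat_recr//= IH exprS; field.
by rewrite gt_eqF.
Qed.

Lemma volume_shell_le k : (mu (shell k) <= ((n.*2%:R + 1) * q ^+ k)%:E)%E.
Proof.
have q0 m : 0 < q ^+ m by rewrite exprn_gt0// invr_gt0.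
(* [volume_shell] needs a positive inner radius; the innermost shell is bounded by the whole ball,
   which accounts for the extra 1 in the constant. *)
case: k => [|k].
  rewrite expr0 mulr1; apply: (@le_trans _ _ (mu (@Ball R n))).
    apply: le_measure; rewrite ?inE; [exact: measurable_shell|exact: measurable_Ball|].
    by move=> z /= /andP[_ h]; rewrite /Ball/=; apply: (lt_le_trans h); rewrite gerBl ltW.
  by rewrite hmu.2 lee_fin lerDr ler0n.
have qS : q ^+ k.+2 < q ^+ k.+1.
  by rewrite [ltLHS]exprS gtr_pMl// /q invf_lt1// ltr1n.
apply: le_trans (volume_shell hmu _ _ _) _.
- by rewrite subr_gt0 exprn_ilt1 ?invr_ge0// /q invf_lt1// ltr1n.
- by rewrite ltrD2l ltrN2.
- by rewrite gerBl ltW.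
- rewrite lee_fin; have := q0 k.+2; have := q0 k.+1; have : (0 : R) <= n.*2%:R by [].
  move=> *; nra.
Qed.

Lemma bigcup_shell : \bigcup_k shell k = @Ball R n.
Proof.
have q0 m : 0 < q ^+ m by rewrite exprn_gt0// invr_gt0.
apply/seteqP; split => [z [k _ /= /andP[_ h]]|z Bz].
  by rewrite /Ball/=; apply: (lt_le_trans h); rewrite gerBl ltW.
have hex : exists k, normC z < 1 - q ^+ k.+1.
  have [k hk] : exists k, q ^+ k.+1 < 1 - normC z.
    have z1 : 0 < 1 - normC z by rewrite subr_gt0.
    exists (Num.truncn (1 - normC z)^-1); rewrite /q exprVn invf_plt ?posrE ?exprn_gt0//.
    apply: (lt_trans (truncnS_gt _)); rewrite -natrX ltr_nat; exact: ltn_expl.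
  by exists k; rewrite ltrBrDr addrC -ltrBrDr.
(* The least k whose outer radius exceeds |z|: minimality yields the inner bound. *)
exists (ex_minn hex) => //; case: ex_minnP => k hk hmin /=.
apply/andP; split => //; case: k hk hmin => [|k] hk hmin.
  by rewrite expr0 subrr normC_ge0.
by rewrite leNgt; apply/negP => /hmin; rewrite ltnn.
Qed.

Lemma trivIset_shell : trivIset setT shell.
Proof.
apply: ltn_trivIset => k m mk; apply/seteqP; split => // z [/= /andP[h1 h2] /andP[h3 h4]].
have : q ^+ k <= q ^+ m.+1 :> R.
  by apply: ler_wiXn2l => //; rewrite /q ?invr_ge0// invf_le1// ler1n.
by move=> h; have := le_lt_trans h3 h2; rewrite ltrD2l ltrN2 => /lt_le_trans /(_ h); rewrite ltxx.
Qed.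

(** Replacing alpha by min(alpha, 1) only enlarges the density, the base being at most 1, and makes
    the exponent non-positive; the power is then largest where 1 - |z|^2 is smallest, and 1 - |z|^2
    >= 2^(-k-1) on the shell. *)
Lemma dens_shell_le k z : shell k z ->
  dens alpha z <= (q `^ (Num.min alpha 1 - 1)) ^+ k.+1.
Proof.
move=> /= /andP[h1 h2].
have q0 m : 0 < q ^+ m by rewrite exprn_gt0// invr_gt0.
have z0 := normC_ge0 z.
have z1 : normC z < 1 by apply: (lt_le_trans h2); rewrite gerBl ltW.
have x1 : q ^+ k.+1 <= 1 - normC z ^+ 2 by nra.
have x2 : 1 - normC z ^+ 2 <= 1 by rewrite gerBl sqr_ge0.
have x0 : 0 < 1 - normC z ^+ 2 by exact: lt_le_trans x1.
rewrite -powR_mulrn ?powR_ge0// -powRrM mulrC powRrM powR_mulrn ?invr_ge0//.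
rewrite /dens; apply: (@le_trans _ _ ((1 - normC z ^+ 2) `^ (Num.min alpha 1 - 1))).
  by apply: ger_powR; rewrite ?x0// lerD2r ge_min lexx.
rewrite !powR_expR// ler_expR ler_wnM2l ?ler_ln ?posrE//.
by rewrite subr_le0 ge_min lexx orbT.
Qed.

(** Volume times density on the k-th shell is at most C r^k with r = 2^(-min(alpha, 1)), and r < 1
    exactly because alpha > 0. *)
Lemma muA_Ball_lty : (muA mu alpha (@Ball R n) < +oo)%E.
Proof.
pose r := q `^ (Num.min alpha 1).
pose C := (n.*2%:R + 1) * q `^ (Num.min alpha 1 - 1).
have C0 : 0 <= C by rewrite mulr_ge0 ?powR_ge0// addr_ge0.
have r0 : 0 <= r by exact: powR_ge0.
have m0 : 0 < Num.min alpha 1 by rewrite lt_min alpha_gt0 ltr01.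
have q0 : 0 < q by rewrite invr_gt0.
have r1 : r < 1.
  rewrite /r powR_expR// -[ltRHS]expR0 ltr_expR pmulr_rlt0// ln_lt0// q0/=.
  by rewrite /q invf_lt1// ltr1n.
have rE : r = q * q `^ (Num.min alpha 1 - 1) by rewrite mulr_powRB1// ltW.
rewrite /muA /intA -bigcup_shell ge0_integral_bigcup//=; last 4 first.
- exact: measurable_shell.
- by apply: measurable_muldens.
- by move=> z _; rewrite mul1e lee_fin dens_ge0.
- exact: trivIset_shell.
apply: (@le_lt_trans _ _ (C * (1 - r)^-1)%:E); last by rewrite ltry.
apply: lime_le.
  apply: is_cvg_nneseries => k _ _; apply: integral_ge0 => z _.
  by rewrite mul1e lee_fin dens_ge0.
apply: nearW => N.
apply: (@le_trans _ _ (\sum_(0 <= k < N) (C * r ^+ k)%:E)%E); last first.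
  by rewrite sumEFin lee_fin -mulr_sumr ler_wpM2l// geometric_sum_le.
apply: lee_sum => k _.
apply: (@le_trans _ _ (\int[mu]_(z in shell k) ((q `^ (Num.min alpha 1 - 1)) ^+ k.+1)%:E)%E).
  apply: ge0_le_integral => //.
  - exact: measurable_shell.
  - by move=> z _; rewrite mul1e lee_fin dens_ge0.
  - by apply: measurable_muldens.
  - by move=> z Fz; rewrite mul1e lee_fin dens_shell_le.
rewrite integral_cst; last exact: measurable_shell.
apply: (@le_trans _ _ (((q `^ (Num.min alpha 1 - 1)) ^+ k.+1)%:E * ((n.*2%:R + 1) * q ^+ k)%:E)%E).
  by rewrite lee_wpmul2l ?volume_shell_le// lee_fin exprn_ge0// powR_ge0.
rewrite -EFinM lee_fin rE /C exprS exprMn le_eqVlt; apply/orP; left; apply/eqP; ring.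
Qed.

End Finite.

(** * The pseudo-distance *)

Section Geometry.
Variables (R : realType) (n : nat).
Local Notation T := (Cn R n).
Implicit Types (x z w a b u : T) (t s r : R).

Definition sqd z w : R := \sum_(j < n)
  (((tnth z j).1 - (tnth w j).1) ^+ 2 + ((tnth z j).2 - (tnth w j).2) ^+ 2).

Definition angle a b : R := Num.sqrt ((1 - reInner a b) ^+ 2 + (imInner a b) ^+ 2).

Definition direction z : T := scale_tuple (normC z)^-1 z.

Lemma normC_sqr z : normC z ^+ 2 =
  \sum_(j < n) ((tnth z j).1 ^+ 2 + (tnth z j).2 ^+ 2).
Proof. by rewrite sqr_sqrtr// sumr_ge0// => j _; rewrite addr_ge0 ?sqr_ge0. Qed.

Lemma sqd_ge0 z w : 0 <= sqd z w.
Proof. by apply: sumr_ge0 => j _; rewrite addr_ge0 ?sqr_ge0. Qed.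

Lemma sqdE z w : sqd z w = normC z ^+ 2 + normC w ^+ 2 - 2 * reInner z w.
Proof.
rewrite !normC_sqr /sqd /reInner mulr_sumr -!sumrN -!big_split/=.
by apply: eq_bigr => j _; ring.
Qed.

Lemma sqd_eq0 z w : sqd z w = 0 -> z = w.
Proof.
move=> /eqP; rewrite psumr_eq0; last by move=> j _; rewrite addr_ge0 ?sqr_ge0.
move=> /allP h; apply: eq_from_tnth => j.
have := h j (mem_index_enum j); rewrite paddr_eq0 ?sqr_ge0// !sqrf_eq0 !subr_eq0.
by case: (tnth z j) (tnth w j) => ? ? [? ?] /= /andP[/eqP -> /eqP ->].
Qed.

Lemma reInner_scale s t z w :
  reInner (scale_tuple s z) (scale_tuple t w) = s * t * reInner z w.
Proof.
by rewrite /reInner mulr_sumr; apply: eq_bigr => j _; rewrite !tnth_mktuple/=; ring.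
Qed.

Lemma imInner_scale s t z w :
  imInner (scale_tuple s z) (scale_tuple t w) = s * t * imInner z w.
Proof.
by rewrite /imInner mulr_sumr; apply: eq_bigr => j _; rewrite !tnth_mktuple/=; ring.
Qed.

Lemma scale_tuple_comp s t z : scale_tuple s (scale_tuple t z) = scale_tuple (s * t) z.
Proof. by apply: eq_from_tnth => j; rewrite !tnth_mktuple/= !mulrA. Qed.

Lemma scale_tuple1 z : scale_tuple 1 z = z.
Proof.
by apply: eq_from_tnth => j; rewrite !tnth_mktuple/= !mul1r -surjective_pairing.
Qed.

Lemma normC_direction z : normC z != 0 -> normC (direction z) = 1.
Proof. by move=> z0; rewrite normC_scale ?invr_ge0 ?normC_ge0// mulVf. Qed.

Lemma scale_direction z : normC z != 0 -> scale_tuple (normC z) (direction z) = z.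
Proof. by move=> z0; rewrite scale_tuple_comp divff// scale_tuple1. Qed.

Lemma pdistE z w : normC z != 0 -> normC w != 0 ->
  pdist z w = `|normC z - normC w| + angle (direction z) (direction w).
Proof.
move=> z0 w0; rewrite /pdist z0 w0/= /angle reInner_scale imInner_scale.
by rewrite -invfM !(mulrC _^-1).
Qed.

Lemma pdist0E z w : normC z = 0 \/ normC w = 0 -> pdist z w = normC z + normC w.
Proof. by rewrite /pdist => -[->|->]; rewrite eqxx ?andbF. Qed.

Lemma angle_ge0 a b : 0 <= angle a b. Proof. exact: sqrtr_ge0. Qed.

Lemma angle_re a b : `|1 - reInner a b| <= angle a b.
Proof. by rewrite -sqrtr_sqr ler_wsqrtr// lerDl sqr_ge0. Qed.

Lemma angle_im a b : `|imInner a b| <= angle a b.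
Proof. by rewrite -[leLHS]sqrtr_sqr ler_wsqrtr// lerDr sqr_ge0. Qed.

Lemma angle_le a b : angle a b <= `|1 - reInner a b| + `|imInner a b|.
Proof.
set x := 1 - _; set y := imInner _ _.
rewrite -(@ler_pXn2r _ 2)// ?nnegrE ?sqrtr_ge0 ?addr_ge0//.
rewrite sqr_sqrtr ?addr_ge0 ?sqr_ge0//.
rewrite -(real_normK (num_real x)) -(real_normK (num_real y)).
by have := normr_ge0 x; have := normr_ge0 y; nra.
Qed.

(** Cauchy-Schwarz in its arithmetic-geometric form, which already gives the bound 1 on unit
    vectors. *)
Lemma reInner_le z w : `|reInner z w| <= (normC z ^+ 2 + normC w ^+ 2) / 2.
Proof.
rewrite !normC_sqr -big_split/= mulr_suml; apply: le_trans (ler_norm_sum _ _ _) _.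
apply: ler_sum => j _; move: (tnth z j) (tnth w j) => [a1 a2] [b1 b2]/=.
have := sqr_ge0 (a1 - b1); have := sqr_ge0 (a2 - b2).
have := sqr_ge0 (a1 + b1); have := sqr_ge0 (a2 + b2) => *.
by rewrite ler_norml; apply/andP; split; nra.
Qed.

Lemma imInner_le z w : `|imInner z w| <= (normC z ^+ 2 + normC w ^+ 2) / 2.
Proof.
rewrite !normC_sqr -big_split/= mulr_suml; apply: le_trans (ler_norm_sum _ _ _) _.
apply: ler_sum => j _; move: (tnth z j) (tnth w j) => [a1 a2] [b1 b2]/=.
have := sqr_ge0 (a2 - b1); have := sqr_ge0 (a1 - b2).
have := sqr_ge0 (a2 + b1); have := sqr_ge0 (a1 + b2) => *.
by rewrite ler_norml; apply/andP; split; nra.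
Qed.

Lemma sqd_unit a b : normC a = 1 -> normC b = 1 -> sqd a b = 2 * (1 - reInner a b).
Proof. by move=> a1 b1; rewrite sqdE a1 b1; ring. Qed.

Lemma sqdC z w : sqd z w = sqd w z.
Proof. by apply: eq_bigr => j _; ring. Qed.

Lemma sqd_quasi u a b : sqd a b <= 2 * (sqd u a + sqd u b).
Proof.
rewrite /sqd -big_split/= mulr_sumr; apply: ler_sum => j _.
move: (tnth a j) (tnth b j) (tnth u j) => [a1 a2] [b1 b2] [u1 u2]/=.
have := sqr_ge0 (a1 + b1 - 2 * u1); have := sqr_ge0 (a2 + b2 - 2 * u2); nra.
Qed.

(** Since Im <u, u> = 0, expanding E = Im <a - u, b - u> leaves the two first order terms. The
    remainder E is quadratic, hence bounded by squared distances, which on unit vectors are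
    themselves of the order of [angle]. *)
Lemma imInner_quasi u a b : `|imInner a b| <=
  `|imInner u a| + `|imInner u b| + (sqd u a + sqd u b) / 2.
Proof.
pose E := \sum_(j < n) (((tnth a j).2 - (tnth u j).2) * ((tnth b j).1 - (tnth u j).1)
  - ((tnth a j).1 - (tnth u j).1) * ((tnth b j).2 - (tnth u j).2)).
have -> : imInner a b = - imInner u a + imInner u b + E.
  rewrite /imInner /E -sumrN -!big_split/=; apply: eq_bigr => j _; ring.
apply: le_trans (ler_normD _ _) _; apply: lerD.
  by apply: le_trans (ler_normD _ _) _; rewrite normrN.
rewrite /sqd -big_split/= mulr_suml; apply: le_trans (ler_norm_sum _ _ _) _.
apply: ler_sum => j _.
move: (tnth a j) (tnth b j) (tnth u j) => [a1 a2] [b1 b2] [u1 u2]/=.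
have := sqr_ge0 ((a2 - u2) - (b1 - u1)); have := sqr_ge0 ((a1 - u1) - (b2 - u2)).
have := sqr_ge0 ((a2 - u2) + (b1 - u1)); have := sqr_ge0 ((a1 - u1) + (b2 - u2)).
by move=> *; rewrite ler_norml; apply/andP; split; nra.
Qed.

(** The quasi-triangle inequality that makes [pdist] usable. The constant is 2 + 2: [sqd_quasi]
    gives 2 for the real part, and [imInner_quasi] gives 1 plus a quadratic term worth 1 for the
    imaginary part. *)
Lemma angle_quasi u a b : normC u = 1 -> normC a = 1 -> normC b = 1 ->
  angle a b <= 4 * (angle u a + angle u b).
Proof.
move=> u1 a1 b1; apply: le_trans (angle_le _ _) _.
have h1 := sqd_quasi u a b; have h2 := imInner_quasi u a b.
have := sqd_ge0 a b.
move: h1 h2; rewrite !sqd_unit// => h1 h2 h3.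
have := angle_re u a; have := angle_re u b.
have := angle_im u a; have := angle_im u b.
rewrite (ger0_norm (_ : 0 <= 1 - reInner a b)); last lra.
move: (ler_norm (1 - reInner u a)) (ler_norm (1 - reInner u b)); lra.
Qed.

Lemma angle_le3 a b : normC a = 1 -> normC b = 1 -> angle a b <= 3.
Proof.
move=> a1 b1; apply: le_trans (angle_le _ _) _.
have := reInner_le a b; have := imInner_le a b; rewrite a1 b1 expr1n => h1.
rewrite ler_norml => /andP[h2 h3].
by rewrite (ger0_norm (_ : 0 <= 1 - reInner a b)); lra.
Qed.

Lemma pdist_ge0 z w : 0 <= pdist z w.
Proof.
rewrite /pdist; case: ifP => _; rewrite addr_ge0 ?normC_ge0//; exact: sqrtr_ge0.
Qed.

Lemma pdist_le4 z w : Ball z -> Ball w -> pdist z w <= 4.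
Proof.
rewrite /Ball/= => z1 w1; have z0 := normC_ge0 z; have w0 := normC_ge0 w.
have [zE|zN] := eqVneq (normC z) 0; first by rewrite pdist0E; [lra|left].
have [wE|wN] := eqVneq (normC w) 0; first by rewrite pdist0E; [lra|right].
rewrite pdistE//; have := angle_le3 (normC_direction zN) (normC_direction wN).
have : `|normC z - normC w| <= 1 by rewrite ler_norml; apply/andP; split; lra.
lra.
Qed.

Lemma pdist_pball_le x r z w : Ball x -> 1 - normC x < r ->
  pball x r z -> pball x r w -> pdist z w <= 8 * Num.min r 1.
Proof.
move=> Bx xr [Bz zr] [Bw wr]; have h4 := pdist_le4 Bz Bw.
have x0 := normC_ge0 x; have z0 := normC_ge0 z; have w0 := normC_ge0 w.
suff : pdist z w <= 8 * r by case: (leP r 1) => ? ?; lra.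
(* Where polar coordinates fail, the global bound 4 suffices: x = 0 forces r > 1, while z = 0 or w =
   0 gives r > |x| next to r > 1 - |x|, so r > 1/2 and 8 r > 4. *)
have [xE|xN] := eqVneq (normC x) 0; first lra.
have [zE|zN] := eqVneq (normC z) 0.
  by move: zr; rewrite pdist0E; [lra|right].
have [wE|wN] := eqVneq (normC w) 0.
  by move: wr; rewrite pdist0E; [lra|right].
move: zr wr; rewrite !pdistE// => zr wr.
have := angle_quasi (normC_direction xN) (normC_direction zN) (normC_direction wN).
have := ler_distD (normC x) (normC z) (normC w).
rewrite (distrC (normC z) (normC x)).
have := angle_ge0 (direction x) (direction z).
have := angle_ge0 (direction x) (direction w).
have := normr_ge0 (normC x - normC z); have := normr_ge0 (normC x - normC w).
lra.
Qed.

(** If the pseudo-distance vanishes, the norms agree and the directions have real inner product 1,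
    so the law of cosines [sqdE] makes the Euclidean distance vanish. *)
Lemma pdist_gt0 z w : z <> w -> 0 < pdist z w.
Proof.
move=> zw; rewrite lt_neqAle pdist_ge0 andbT eq_sym; apply/eqP => d0; apply: zw.
apply: sqd_eq0; rewrite sqdE.
have z0 := normC_ge0 z; have w0 := normC_ge0 w.
have hz : normC z = 0 \/ normC w = 0 ->
    normC z ^+ 2 + normC w ^+ 2 - 2 * reInner z w = 0.
  move=> zE; move: d0; rewrite pdist0E// => h.
  have /eqP z0' : normC z == 0 by lra.
  have /eqP w0' : normC w == 0 by lra.
  have := reInner_le z w; rewrite z0' w0' !expr0n/= addr0 mul0r normr_le0 => /eqP ->.
  by rewrite mulr0 subr0.
have [zE|zN] := eqVneq (normC z) 0; first by apply: hz; left.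
have [wE|wN] := eqVneq (normC w) 0; first by apply: hz; right.
move: d0; rewrite pdistE// => d0.
have hn : `|normC z - normC w| = 0.
  by have := angle_ge0 (direction z) (direction w);
     have := normr_ge0 (normC z - normC w); lra.
have hw : normC w = normC z by move/eqP: hn; rewrite normr_eq0 subr_eq0 => /eqP.
have hre : 1 - reInner (direction z) (direction w) = 0.
  apply/eqP; rewrite -normr_le0; apply: le_trans (angle_re _ _) _; lra.
have := reInner_scale (normC z) (normC w) (direction z) (direction w).
rewrite !scale_direction// (_ : reInner (direction z) _ = 1); last lra.
by move=> ->; rewrite hw; ring.
Qed.

(* Only the imaginary part is first order in the displacement [delta]:
   [sqd z (t u) = (|z| - t)^2 + 2 |z| t (1 - Re <z, u> / |z|)] makes the real
   part second order. *)
Lemma pdist_near u s t (delta : R) z : normC u = 1 -> 0 <= s -> 0 < t ->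
  0 < delta -> delta <= t / 2 -> sqd z (scale_tuple t u) <= delta ^+ 2 ->
  `|normC z - t| <= delta /\
  pdist (scale_tuple s u) z <= `|s - t| + delta + 5 / 2 * (delta / t).
Proof.
move=> u1 s0 t0 d0 dt hz.
have y1 : normC (scale_tuple t u) = t by rewrite normC_scale ?ltW// u1 mulr1.
set y := scale_tuple t u in hz y1 *.
have nz0 := normC_ge0 z; have d2 : delta ^+ 2 <= (t / 2) ^+ 2 by nra.
(* If z = 0 then t^2 <= 2 [sqd z y] <= 2 (t / 2)^2, which is absurd. *)
have zN : normC z != 0.
  apply/eqP => z0.
  have : normC y ^+ 2 <= 2 * (sqd z y + normC z ^+ 2).
    rewrite !normC_sqr /sqd -big_split/= mulr_sumr; apply: ler_sum => j _.
    move: (tnth y j) (tnth z j) => [b1 b2] [a1 a2]/=.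
    by have := sqr_ge0 (2 * a1 - b1); have := sqr_ge0 (2 * a2 - b2); nra.
  rewrite z0 expr0n/= addr0 y1 => h; have := exprn_gt0 2 t0; nra.
have zpos : 0 < normC z by rewrite lt_neqAle eq_sym zN.
set v := direction z; have v1 : normC v = 1 by exact: normC_direction.
have zE : z = scale_tuple (normC z) v by rewrite scale_direction.
have [c1 hre] : reInner u v <= 1 /\
    (normC z - t) ^+ 2 + 2 * normC z * t * (1 - reInner u v) <= delta ^+ 2.
  have := sqd_unit u1 v1; have := sqd_ge0 u v => h1 h2; split; first lra.
  have hyz : reInner y z = t * normC z * reInner u v.
    by rewrite [in LHS]zE reInner_scale.
  apply: le_trans hz; rewrite sqdC sqdE y1 hyz.
  by rewrite le_eqVlt; apply/orP; left; apply/eqP; ring.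
have zt : 0 <= normC z * t by rewrite mulr_ge0// ltW.
have hzt : `|normC z - t| <= delta.
  rewrite -(@ler_pXn2r _ 2)// ?nnegrE ?(ltW d0)// real_normK ?num_real//; nra.
split=> //; have [z1 z2] : t - delta <= normC z /\ normC z <= t + delta.
  by move: hzt; rewrite ler_norml => /andP[? ?]; split; lra.
have [s_eq0|s_neq0] := eqVneq s 0.
  rewrite pdist0E; last by left; rewrite normC_scale// s_eq0 mul0r.
  rewrite normC_scale// s_eq0 mul0r add0r sub0r normrN (gtr0_norm t0).
  have : 0 <= delta / t by rewrite divr_ge0// ltW.
  lra.
have sE : normC (scale_tuple s u) = s by rewrite normC_scale// u1 mulr1.
rewrite pdistE ?sE//.
have -> : direction (scale_tuple s u) = u.
  by rewrite /direction sE scale_tuple_comp mulVf// scale_tuple1.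
have hre2 : 1 - reInner u v <= (delta / t) / 2.
  have zt2 : 2 * normC z * t >= t ^+ 2 by nra.
  have h : t ^+ 2 * (1 - reInner u v) <= delta * (t / 2).
    have e1 : t ^+ 2 * (1 - reInner u v) <= 2 * normC z * t * (1 - reInner u v).
      by rewrite ler_wpM2r// subr_ge0.
    have e2 : delta ^+ 2 <= delta * (t / 2) by rewrite expr2 ler_wpM2l// ltW.
    by have := sqr_ge0 (normC z - t); lra.
  rewrite -(ler_pM2l (exprn_gt0 2 t0)); apply: (le_trans h).
  by rewrite le_eqVlt; apply/orP; left; apply/eqP; field; rewrite gt_eqF.
have him : `|imInner u v| <= 2 * (delta / t).
  (* As y is a real multiple of u, Im <u, y> = 0 and y may be subtracted from z; the product is then
     split by the arithmetic-geometric inequality with weight [delta]. *)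
  have him1 : `|imInner u z| <= delta.
    have -> : imInner u z = \sum_(j < n)
        ((tnth u j).2 * ((tnth z j).1 - (tnth y j).1)
         - (tnth u j).1 * ((tnth z j).2 - (tnth y j).2)).
      by apply: eq_bigr => j _; rewrite !tnth_mktuple/=; ring.
    have hs : (sqd z y / delta + delta * normC u ^+ 2) / 2 <= delta.
      rewrite u1 expr1n mulr1; have : sqd z y / delta <= delta.
        by rewrite ler_pdivrMr.
      lra.
    apply: le_trans hs; rewrite normC_sqr /sqd mulr_suml mulr_sumr -big_split/= mulr_suml.
    apply: le_trans (ler_norm_sum _ _ _) _; apply: ler_sum => j _.
    move: (tnth u j) (tnth z j) (tnth y j) => [a1 a2] [b1 b2] [e1 e2]/=.
    set A := b1 - e1; set B := b2 - e2.
    have h1 : 2 * (a2 * A - a1 * B) - delta * (a1 ^+ 2 + a2 ^+ 2) <=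
        (A ^+ 2 + B ^+ 2) / delta.
      rewrite ler_pdivlMr//; have := sqr_ge0 (A - delta * a2).
      have := sqr_ge0 (B + delta * a1); nra.
    have h2 : - 2 * (a2 * A - a1 * B) - delta * (a1 ^+ 2 + a2 ^+ 2) <=
        (A ^+ 2 + B ^+ 2) / delta.
      rewrite ler_pdivlMr//; have := sqr_ge0 (A + delta * a2).
      have := sqr_ge0 (B - delta * a1); nra.
    by rewrite ler_norml; apply/andP; split; lra.
  have : `|imInner u z| = normC z * `|imInner u v|.
    rewrite [in LHS]zE -[u in LHS]scale_tuple1 imInner_scale mul1r normrM.
    by rewrite (gtr0_norm zpos).
  move=> h; rewrite h in him1.
  have h1 : t / 2 * `|imInner u v| <= delta.
    by apply: le_trans him1; rewrite ler_wpM2r//; lra.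
  by rewrite mulrA ler_pdivlMr//; nra.
(* The constant is 5/2 = 1/2 + 2, the real part plus the imaginary part. *)
have := angle_le u v; rewrite (ger0_norm (_ : 0 <= 1 - reInner u v)); last lra.
have := ler_distD t s (normC z); rewrite (distrC t (normC z)).
lra.
Qed.

End Geometry.

(** * Pseudo-balls touching the boundary *)

Section PseudoBalls.
Variables (R : realType) (n : nat).
Local Notation T := (Cn R n).
Variables (mu : {measure set T -> \bar R}) (alpha : R).
Hypothesis n_gt0 : (0 < n)%N.
Hypothesis hmu : is_normalized_volume mu.
Hypothesis alpha_gt0 : 0 < alpha.

Lemma polar_decomposition (x : T) :
  exists u : T, normC u = 1 /\ x = scale_tuple (normC x) u.
Proof.
have [x0|xN] := eqVneq (normC x) 0; last first.
  by exists (direction x); rewrite normC_direction// scale_direction.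
(* The origin has no direction of its own; the first basis vector serves. *)
exists [tuple (if i == Ordinal n_gt0 then 1 else 0, 0) | i < n]; split.
  rewrite /normC (bigD1 (Ordinal n_gt0))//= tnth_mktuple/= ?eqxx.
  rewrite big1 ?expr1n ?expr0n ?addr0 ?sqrtr1// => j /negPf jN.
  by rewrite tnth_mktuple/= jN expr0n addr0.
apply: sqd_eq0; rewrite sqdE normC_scale ?normC_ge0//.
have := reInner_le x
  (scale_tuple (normC x) [tuple (if i == Ordinal n_gt0 then 1 else 0, 0) | i < n]).
rewrite normC_scale ?normC_ge0// x0 !mul0r !expr0n/= addr0 mul0r normr_le0 => /eqP ->.
by rewrite mulr0 subr0.
Qed.

Lemma small_box : exists2 c : R, 0 < c & forall (y : T) (delta : R), 0 < delta ->
  exists A : set T, [/\ measurable A, mu A = (c * delta ^+ n.*2)%:E &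
    forall z, A z -> sqd z y <= delta ^+ 2].
Proof.
have [c [c0 hbox]] := hmu.1.
have n0 : 0 < n%:R :> R by rewrite ltr0n.
exists (c * (n%:R^-1) ^+ n.*2); first by rewrite mulr_gt0// exprn_gt0// invr_gt0.
(* With half-side [delta / (2 n)] the squared distance to the centre is at most 2 n h^2 = delta^2 /
   (2 n). *)
move=> y delta d0; pose h := delta / (2 * n%:R).
have h0 : 0 < h by rewrite divr_gt0// mulr_gt0.
exists (box (fun j => ((tnth y j).1 - h, (tnth y j).2 - h))
            (fun j => ((tnth y j).1 + h, (tnth y j).2 + h))); split.
- exact: measurable_box.
- rewrite hbox; last by move=> j /=; split; rewrite lerD2l; lra.
  congr EFin; rewrite -mulrA; congr (_ * _).
  rewrite -exprMn -muln2 mulnC exprM.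
  rewrite (_ : forall x : R, x ^+ n = \prod_(j < n) x); last first.
    by move=> x; rewrite prodr_const card_ord.
  apply: eq_bigr => j _ /=; rewrite /h; field.
  by rewrite gt_eqF.
- move=> z hz; apply: (@le_trans _ _ (\sum_(j < n) (2 * h ^+ 2))).
    apply: ler_sum => j _; have := hz j => /=.
    move: (tnth z j) (tnth y j) => [a1 a2] [b1 b2]/= [/andP[? ?] /andP[? ?]].
    have e1 : (a1 - b1) ^+ 2 <= h ^+ 2 by nra.
    have e2 : (a2 - b2) ^+ 2 <= h ^+ 2 by nra.
    lra.
  rewrite sumr_const card_ord -[leLHS]mulr_natr /h.
  have -> : 2 * (delta / (2 * n%:R)) ^+ 2 * n%:R = delta ^+ 2 * (2 * n%:R)^-1.
    by field; rewrite gt_eqF.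
  rewrite ler_piMr ?sqr_ge0// invf_le1 ?mulr_gt0//.
  by have : 1 <= n%:R :> R; [rewrite ler1n|lra].
Qed.

Lemma pdist_neighborhood (x : T) (eps : R) : Ball x -> 0 < eps ->
  exists A : set T, [/\ measurable A, (0 < mu A)%E &
    forall z, A z -> Ball z /\ pdist x z <= eps].
Proof.
rewrite /Ball/= => x1 e0; have [c c0 hb] := small_box.
have [u [u1 xE]] := polar_decomposition x.
have s0 := normC_ge0 x; set s := normC x in x1 xE s0.
suff [t [delta [t0 d0 dt td hd]]] : exists t delta : R,
    [/\ 0 < t, 0 < delta, delta <= t / 2, t + delta < 1 &
      `|s - t| + delta + 5 / 2 * (delta / t) <= eps].
  have [A [mA muA hA]] := hb (scale_tuple t u) delta d0.
  exists A; split => //.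
    by rewrite muA lte_fin mulr_gt0// exprn_gt0.
  move=> z /hA hz; have [h1 h2] := pdist_near u1 s0 t0 d0 dt hz.
  split; last by rewrite xE; apply: le_trans hd.
  by move: h1; rewrite /= ler_norml => /andP[? ?]; lra.
have [sE|sN] := eqVneq s 0.
  (* At the origin the box must sit off centre; [delta = t^2] turns [delta / t] into t, and the
     total t + t^2 + 5t/2 stays below 8t <= eps. *)
  pose t := Num.min eps 1 / 8.
  have [m1 m2 m0] : [/\ Num.min eps 1 <= eps, Num.min eps 1 <= 1 & 0 < Num.min eps 1].
    by split; rewrite ?ge_min ?lexx ?orbT// lt_min e0 ltr01.
  have t0 : 0 < t by rewrite /t; lra.
  have t8 : t <= 1 / 8 by rewrite /t; lra.
  have te : 8 * t <= eps by rewrite /t; lra.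
  exists t, (t ^+ 2); rewrite sE sub0r normrN gtr0_norm// expr2 mulfK ?gt_eqF//.
  split; nra.
have sp : 0 < s by rewrite lt_neqAle eq_sym sN.
(* The three bounds keep the box away from 0, inside the ball, and within eps: since s < 1, the
   total is at most (7/2) delta / s <= eps / 2. *)
pose delta := Num.min (s / 2) (Num.min ((1 - s) / 2) (eps * s / 7)).
have d0 : 0 < delta.
  by rewrite /delta !lt_min !divr_gt0 ?mulr_gt0 ?subr_gt0.
have [d1 d2 d3] : [/\ delta <= s / 2, delta <= (1 - s) / 2 & delta <= eps * s / 7].
  by split; rewrite /delta !ge_min !lexx ?orbT.
exists s, delta; rewrite subrr normr0 add0r; split => //; first lra.
have : delta / s <= eps / 7 by rewrite ler_pdivrMr//; lra.
have : delta <= delta / s by rewrite ler_pMr// invf_ge1// ltW.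
lra.
Qed.

(** The density may degenerate at the sphere, so the pseudo-ball is tested on a Euclidean box of
    size proportional to rho = min(r, 1) whose distance to the sphere is also proportional to
    rho. *)
Lemma muA_pball_ge : exists2 c : R, 0 < c & exists N : nat, forall (x : T) (r : R),
  Ball x -> 1 - normC x < r ->
  ((c * Num.min r 1 ^+ N)%:E <= muA mu alpha (pball x r))%E.
Proof.
have [c c0 hb] := small_box.
(* An integer exponent k >= alpha - 1 bounds the density below by (1 - |z|^2)^k, since the base is
   at most 1. *)
pose k := (Num.truncn alpha).+1.
have ak : alpha - 1 <= k%:R.
  have : alpha < k%:R by exact: truncnS_gt.
  lra.
exists (c * (72^-1) ^+ n.*2 * (8^-1) ^+ k).
  by rewrite !mulr_gt0// exprn_gt0// invr_gt0.
exists (n.*2 + k)%N => x r Bx xr.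
have [u [u1 xE]] := polar_decomposition x.
have s0 := normC_ge0 x; move: (Bx); rewrite /Ball/= => s1.
set s := normC x in s0 s1 xE xr.
set rho := Num.min r 1.
have [r1 rr r0] : [/\ rho <= 1, rho <= r & 0 < rho].
  by split; rewrite /rho ?ge_min ?lexx ?orbT// lt_min ltr01 andbT; lra.
(* The box is centred at t u with delta = rho / 72. As t >= 1/4, [pdist_near] adds at most delta +
   (5/2) 4 delta = 11 rho / 72 to |s - t|; the last condition keeps the box at depth rho / 8. *)
suff [t [t0 ts td]] : exists t : R, [/\ 1 / 4 <= t,
    `|s - t| + 11 / 72 * rho < rho & t + rho / 72 <= 1 - rho / 8].
  have tp : 0 < t by lra.
  have d0 : 0 < rho / 72 by lra.
  have dt : rho / 72 <= t / 2 by lra.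
  have [A [mA muA hA]] := hb (scale_tuple t u) _ d0.
  have hz z : A z -> normC z <= 1 - rho / 8 /\ pdist x z < rho.
    move=> /hA h; have [h1 h2] := pdist_near u1 s0 tp d0 dt h.
    split; first by move: h1; rewrite ler_norml => /andP[? ?]; lra.
    rewrite xE; apply: le_lt_trans h2 _.
    have : rho / 72 / t <= 4 * (rho / 72).
      rewrite ler_pdivrMr//; nra.
    lra.
  have AB : A `<=` pball x r.
    move=> z /hz [h1 h2]; split; last exact: lt_le_trans rr.
    by rewrite /Ball/=; lra.
  apply: (@le_trans _ _ (Defs.muA mu alpha A)); last first.
    by apply: intA_subset => //; exact: measurable_pball.
  apply: (@le_trans _ _ (\int[mu]_(z in A) ((rho / 8) ^+ k)%:E)%E); last first.
    apply: ge0_le_integral => //.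
    - by move=> z _; rewrite lee_fin exprn_ge0//; lra.
    - by apply: measurable_muldens.
    - move=> z /hz [h1 _]; rewrite mul1e lee_fin.
      have z0 := normC_ge0 z.
      have h8 : rho / 8 <= 1 - normC z ^+ 2 by nra.
      have x0 : 0 < 1 - normC z ^+ 2 by lra.
      apply: (@le_trans _ _ ((1 - normC z ^+ 2) ^+ k)).
        by rewrite lerXn2r// ?nnegrE; lra.
      rewrite -(@powR_mulrn _ (1 - normC z ^+ 2) k) ?(ltW x0)// /dens; apply: ger_powR => //.
      by rewrite x0 gerBl sqr_ge0.
  rewrite integral_cst// muA -EFinM lee_fin le_eqVlt; apply/orP; left; apply/eqP.
  by rewrite exprD !exprMn; ring.
(* Away from the origin, move inward by a factor 1 - rho / 4. Otherwise r > 1 - s gives rho > 1/2,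
   and radius 1/4 is close enough to s. *)
have [sh|sh] := leP (1 / 2) s.
  exists (s * (1 - rho / 4)); split; [nra| |nra].
  rewrite (_ : s - _ = s * (rho / 4)); last by ring.
  rewrite ger0_norm; nra.
exists (1 / 4); split => //; last lra.
have rh : 1 / 2 < rho by rewrite /rho lt_min; apply/andP; split; lra.
have : `|s - 1 / 4| <= 1 / 4 by rewrite ler_norml; apply/andP; split; lra.
lra.
Qed.

Definition origin : T := [tuple (0, 0) | i < n].

Lemma normC_origin : normC origin = 0.
Proof.
rewrite /normC big1 ?sqrtr0// => i _.
by rewrite tnth_mktuple/= expr0n addr0.
Qed.

Lemma Ball_origin : Ball origin. Proof. by rewrite /Ball/= normC_origin. Qed.

Lemma Bfam_Ball : Bfam (@Ball R n).
Proof.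
(* Any radius above the bound 4 of [pdist_le4] would do. *)
exists origin, 5; split; first exact: Ball_origin.
split; first by rewrite normC_origin; lra.
apply/seteqP; split => [z Bz|z []//].
by split => //; apply: le_lt_trans (pdist_le4 Ball_origin Bz) _; lra.
Qed.

Lemma Bfam_subset (B : set T) : Bfam B -> B `<=` @Ball R n.
Proof. by move=> [z [r [_ [_ ->]]]] w []. Qed.

Lemma measurable_Bfam (B : set T) : Bfam B -> measurable B.
Proof. by move=> [z [r [_ [_ ->]]]]; exact: measurable_pball. Qed.

Lemma muA_Bfam_fin (B : set T) : Bfam B ->
  (0 < fine (muA mu alpha B) <= fine (muA mu alpha (@Ball R n))) /\
  muA mu alpha B = (fine (muA mu alpha B))%:E.
Proof.
move=> hB; have mB := measurable_Bfam hB; have BB := Bfam_subset hB.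
have leB : (muA mu alpha B <= muA mu alpha (@Ball R n))%E.
  by apply: intA_subset => //; exact: measurable_Ball.
have fB := muA_Ball_lty hmu alpha_gt0.
have lB := le_lt_trans leB fB.
have B0 : (0 < muA mu alpha B)%E.
  have [c c0 [N hN]] := muA_pball_ge.
  move: hB => [x [r [Bx [xr ->]]]]; apply: lt_le_trans (hN x r Bx xr).
  rewrite lte_fin mulr_gt0// exprn_gt0// lt_min ltr01 andbT.
  by move: Bx xr; rewrite /Ball/=; lra.
have finB : muA mu alpha B \is a fin_num by rewrite ge0_fin_numE// ltW.
rewrite fineK//; split=> //; rewrite fine_gt0 ?B0//= fine_le//.
by rewrite ge0_fin_numE// (le_trans _ leB)// ltW.
Qed.

End PseudoBalls.

(** * The exponent *)

Section Exponent.
Variables (R : realType) (n : nat).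
Local Notation T := (Cn R n).
Variables (mu : {measure set T -> \bar R}) (alpha : R) (p : T -> R).
Hypothesis n_gt0 : (0 < n)%N.
Hypothesis hmu : is_normalized_volume mu.
Hypothesis alpha_gt0 : 0 < alpha.
Hypothesis hp : Plog mu p.

Lemma ln_e_ge1 (d : R) : 0 <= d -> 1 <= ln (expR 1 + d).
Proof.
move=> d0; rewrite -{1}(expRK (1 : R)) ler_ln ?posrE ?expR_gt0//.
  by rewrite lerDl.
by rewrite ltr_pwDl ?expR_gt0.
Qed.

(* The log-Hoelder condition makes [p] continuous and nonempty open sets have
   positive measure, so the essential lower bound holds at every point. *)
Lemma exponent_lower_bound : exists2 pm : R, 1 < pm &
  forall z, Ball z -> pm <= p z.
Proof.
have [_ [inf1 [c hc]]] := hp.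
set f := (fun z => if _ then _ else _) in inf1.
have [pm pm1 pminf] : exists2 pm : R, 1 < pm & (pm%:E <= ess_inf mu f)%E.
  move: inf1; case: (ess_inf mu f) => [r|_|//]; first by rewrite lte_fin; exists r.
  (* An essential infimum equal to +oo is not excluded a priori; any real above 1 serves then. *)
  by exists 2; [lra|rewrite leey].
exists pm => // x Bx; rewrite leNgt; apply/negP => px.
pose e := pm - p x; have e0 : 0 < e by rewrite subr_gt0.
(* At this distance ln (e + 1/d) exceeds |c| / (pm - p x), so p cannot climb back to pm. *)
have eps0 : 0 < expR (- (`|c| / e)) by exact: expR_gt0.
have [A [mA A0 hA]] := pdist_neighborhood n_gt0 hmu Bx eps0.
have hlt z : A z -> p z < pm.
  move=> /hA[Bz dz]; have [->//|/eqP zx] := eqVneq z x.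
  have xz : x <> z by move/esym.
  have := hc x z Bx Bz xz; have d0 := pdist_gt0 xz.
  set L := ln _ => hL.
  have L1 : 1 <= L by apply: ln_e_ge1; rewrite invr_ge0 ltW.
  have hcL : c / L < e.
    apply: (@le_lt_trans _ _ (`|c| / L)).
      by rewrite ler_wpM2r ?invr_ge0 ?ler_norm//; lra.
    rewrite ltr_pdivrMr ?(lt_le_trans ltr01)// mulrC -ltr_pdivrMr//.
    rewrite -ltr_expR lnK ?posrE; last by rewrite addr_gt0 ?expR_gt0// invr_gt0.
    apply: (@le_lt_trans _ _ (pdist x z)^-1); last by rewrite ltrDr expR_gt0.
    by rewrite -[leLHS]invrK -expRN lef_pV2 ?posrE ?expR_gt0.
  by move: hL hcL; rewrite ler_norml /e => /andP[? ?] ?; lra.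
(* The points where f is below its essential infimum lie in the null set N, yet they include A. *)
have [N [mN N0 hN]] := ess_inf_le mu f.
have : (mu A <= mu N)%E.
  apply: le_measure; rewrite ?inE// => z Az; apply: hN => /= h.
  have := le_trans pminf h; rewrite /f; have [Bz _] := hA z Az.
  by rewrite asboolT// lee_fin leNgt hlt.
by rewrite N0 leNgt A0.
Qed.

Lemma exponent_oscillation : exists2 k : R, 0 <= k & forall B : set T, Bfam B ->
  forall z w, B z -> B w ->
  `|p z - p w| * (1 + `|ln (fine (muA mu alpha B))|) <= k.
Proof.
have [_ [_ [c hc]]] := hp.
have [c' c'0 [N hN]] := muA_pball_ge alpha n_gt0 hmu.
pose m0 := fine (muA mu alpha (@Ball R n)).
pose C1 := 1 + `|ln m0| + `|ln c'|.
have C10 : 0 <= C1 by rewrite !addr_ge0.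
(* |ln m| is at most a constant plus N (-ln rho), and -ln rho <= L' + ln 8. Since L' >= 1, additive
   constants are absorbed into a multiple of L'. *)
pose K := C1 + N%:R * (1 + ln 8).
have ln8 : 0 <= ln (8 : R) by rewrite ln_ge0//; lra.
have N0 : 0 <= N%:R :> R by [].
have K0 : 0 <= K by rewrite addr_ge0// mulr_ge0// addr_ge0.
exists (`|c| * K); first by rewrite mulr_ge0.
move=> B hB z w Bz Bw.
have [->|/eqP zw] := eqVneq z w; first by rewrite subrr normr0 mul0r mulr_ge0.
have [/andP[mB0 mBm0] mBE] := muA_Bfam_fin n_gt0 hmu alpha_gt0 hB.
set m := fine _ in mB0 mBm0 mBE *.
have [B1z B1w] := (Bfam_subset hB Bz, Bfam_subset hB Bw).
have d0 := pdist_gt0 zw; have := hc z w B1z B1w zw; set L' := ln _ => hL.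
have L1 : 1 <= L' by apply: ln_e_ge1; rewrite invr_ge0 ltW.
suff hK : 1 + `|ln m| <= K * L'.
  apply: (@le_trans _ _ ((`|c| / L') * (K * L'))).
    apply: ler_pM => //.
    by apply: (le_trans hL); rewrite ler_wpM2r ?ler_norm// invr_ge0; lra.
  by rewrite le_eqVlt; apply/orP; left; apply/eqP; field; rewrite gt_eqF//; lra.
move: hB => [x [r [Bx [xr BE]]]].
have hmr := hN x r Bx xr; rewrite -BE mBE lee_fin in hmr.
rewrite BE in Bz Bw; have hd := pdist_pball_le Bx xr Bz Bw.
move: hmr hd; set rho := Num.min r 1 => hmr hd.
have r0 : 0 < rho by rewrite lt_min ltr01 andbT; move: Bx xr; rewrite /Ball/=; lra.
have r1 : rho <= 1 by rewrite ge_min lexx orbT.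
have lr : ln rho <= 0 by rewrite ln_le0.
have h1 : ln m <= `|ln m0|.
  by apply: le_trans (ler_norm _); rewrite ler_ln ?posrE// (lt_le_trans mB0).
have h2 : ln c' + N%:R * ln rho <= ln m.
  rewrite mulr_natl -lnXn// -lnM ?posrE ?exprn_gt0// ler_ln ?posrE//.
  by rewrite mulr_gt0// exprn_gt0.
have h3 : - ln rho <= L' + ln 8.
  rewrite -lerBlDr -opprD -lnM ?posrE// -lnV ?posrE ?mulr_gt0//.
  rewrite ler_ln ?posrE ?invr_gt0 ?mulr_gt0// ?addr_gt0 ?expR_gt0 ?invr_gt0//.
  apply: (@le_trans _ _ (pdist z w)^-1); last by rewrite lerDr expR_ge0.
  by rewrite lef_pV2 ?posrE ?mulr_gt0// mulrC.
have h4 : - ln c' <= `|ln c'| by rewrite -normrN ler_norm.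
have h5 : - ln rho <= (1 + ln 8) * L' by nra.
have h6 : C1 <= C1 * L' by rewrite ler_peMr.
have h7 : N%:R * (- ln rho) <= N%:R * ((1 + ln 8) * L') by rewrite ler_wpM2l.
have h8 : 0 <= N%:R * (- ln rho) by rewrite mulr_ge0// oppr_ge0.
have a1 := normr_ge0 (ln m0); have a2 := normr_ge0 (ln c').
have : `|ln m| <= `|ln m0| + `|ln c'| + N%:R * (- ln rho).
  by rewrite ler_norml; apply/andP; split; lra.
by move: h6 h7; rewrite /K /C1 => *; lra.
Qed.

(** [Plog] bounds p from below only; the upper bound is the oscillation estimate on the whole
    ball. *)
Lemma exponent_upper_bound : exists pM : R, forall z, Ball z -> p z <= pM.
Proof.
have [k k0 hk] := exponent_oscillation.
exists (p (origin R n) + k) => z Bz.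
have := hk _ (@Bfam_Ball R n) z (origin R n) Bz (@Ball_origin R n).
set X := `|ln _| => h; have X0 : 0 <= X by exact: normr_ge0.
have : p z - p (origin R n) <= `|p z - p (origin R n)| by exact: ler_norm.
have := normr_ge0 (p z - p (origin R n)); nra.
Qed.

(** p_B is a harmonic mean of p over B. L and U are left free because both the global bounds and the
    local ones around a single value p(z) are needed. *)
Lemma pB_bounds (B : set T) (L U : R) : Bfam B -> 0 < L ->
  (forall z, B z -> L <= p z <= U) -> L <= pB mu alpha p B <= U.
Proof.
move=> hB L0 hLU; have [mp _] := hp.
have mB := measurable_Bfam hB; have BB := Bfam_subset hB.
have [/andP[m0 _] mE] := muA_Bfam_fin n_gt0 hmu alpha_gt0 hB.
have [z0 Bz0] : B !=set0.
  by apply/set0P/eqP => B0; move: m0; rewrite B0 /muA /intA integral_set0/= ltxx.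
have U0 : 0 < U by have /andP[? ?] := hLU _ Bz0; lra.
set m := fine _ in m0 mE.
have mp1 : measurable_fun B (fun z => ((p z)^-1)%:E).
  apply/measurable_EFinP; apply: measurable_fun_inv.
  by apply: measurable_funS mp => //; exact: measurable_Ball.
have pinv z : B z -> U^-1 <= (p z)^-1 <= L^-1.
  move=> /hLU/andP[h1 h2]; have pz : 0 < p z by lra.
  by rewrite !lef_pV2 ?posrE// h1 h2.
have hl : (U^-1 * m <= fine (intA mu alpha B (fun z => ((p z)^-1)%:E)) <= L^-1 * m)%R.
  have h0 z : B z -> (0 <= ((p z)^-1)%:E)%E.
    move=> /pinv/andP[h _]; rewrite lee_fin; apply: le_trans h.
    by rewrite invr_ge0 ltW.
  have I1 : (intA mu alpha B (fun z => ((p z)^-1)%:E) <= (L^-1 * m)%:E)%E.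
    rewrite EFinM -mE -intA_cst ?invr_ge0 ?(ltW L0)//; apply: le_intA => //.
    by move=> z /pinv/andP[_]; rewrite lee_fin.
  have I2 : ((U^-1 * m)%:E <= intA mu alpha B (fun z => ((p z)^-1)%:E))%E.
    rewrite EFinM -mE -intA_cst ?invr_ge0 ?(ltW U0)//; apply: le_intA => //.
      by move=> z _; rewrite lee_fin invr_ge0 ltW.
    by move=> z /pinv/andP[h _]; rewrite lee_fin.
  have fi : intA mu alpha B (fun z => ((p z)^-1)%:E) \is a fin_num.
    by rewrite ge0_fin_numE ?intA_ge0// (le_lt_trans I1)// ltry.
  by rewrite -!lee_fin fineK// I1 I2.
have /andP[h1 h2] := hl; rewrite /pB -/m.
set J := fine _ in h1 h2 *.
have J0 : 0 < J by apply: lt_le_trans h1; rewrite mulr_gt0// invr_gt0.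
have mJ : 0 < m^-1 * J by rewrite mulr_gt0// invr_gt0.
rewrite -[L]invrK -[U]invrK !lef_pV2 ?posrE ?invr_gt0//.
by rewrite ler_pdivrMl// mulrC h2/= ler_pdivlMl// mulrC h1.
Qed.

Lemma pB_oscillation : exists2 k : R, 0 <= k & forall B : set T, Bfam B ->
  forall z, B z ->
  `|p z - pB mu alpha p B| * (1 + `|ln (fine (muA mu alpha B))|) <= k.
Proof.
have [k k0 hk] := exponent_oscillation; have [pm pm1 hpm] := exponent_lower_bound.
exists k => // B hB z Bz; have BB := Bfam_subset hB.
set X := `|ln _|; have X0 : 0 <= X by exact: normr_ge0.
have X1 : 0 < 1 + X by lra.
pose w := k / (1 + X).
have w0 : 0 <= w by rewrite divr_ge0// ltW.
rewrite -ler_pdivlMr// -/w.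
have hw y : B y -> p y <= p z + w /\ p z - w <= p y.
  move=> By; have := hk B hB z y Bz By; rewrite -/X -ler_pdivlMr// -/w ler_norml.
  by move=> /andP[? ?]; split; lra.
(* The maximum with 1 supplies the positive lower bound that [pB_bounds] requires, as p z - w may be
   negative. *)
have /andP[h1 h2] : Num.max 1 (p z - w) <= pB mu alpha p B <= p z + w.
  apply: pB_bounds => //; first by rewrite lt_max ltr01.
  move=> y By; have [? ?] := hw y By; rewrite ge_max; have := hpm y (BB _ By).
  by move=> ?; apply/andP; split; [apply/andP; split; lra|lra].
move: h1; rewrite ge_max => /andP[_ h1].
by rewrite ler_norml; apply/andP; split; lra.
Qed.

End Exponent.

(** * Variable exponent norms *)

Section VariableNorm.
Variables (R : realType) (n : nat).
Local Notation T := (Cn R n).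
Variables (mu : {measure set T -> \bar R}) (alpha : R).
Variables (B : set T) (s : T -> R) (f h : T -> \bar R) (s1 s2 : R).
Hypotheses (mB : measurable B) (BB : B `<=` @Ball R n).
Hypotheses (ms : measurable_fun B s) (mh : measurable_fun B h).
Hypotheses (s1_gt0 : 0 < s1) (hs : forall z, Ball z -> s1 <= s z <= s2).
Hypothesis h_ge0 : forall z, B z -> (0 <= h z)%E.
Hypothesis hfh : forall z l, B z -> 0 < l ->
  ((`|f z| * (l^-1)%:E) `^ s z = h z * (l `^ (- s z))%:E)%E.

Local Notation I := (intA mu alpha B).

(** [hfh] factors the integrand into a mass density h and a power of l, so the three norms can be
    treated at once: (s, h) will be (p, w), (p', w') and (p'/p, w'). Off B the integrand is 0
    because s > 0. *)
Lemma vnorm_modular (l : R) : 0 < l ->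
  intA mu alpha (@Ball R n) (fun z => (`|chi B f z| * (l^-1)%:E) `^ s z)%E =
  I (fun z => h z * (l `^ (- s z))%:E)%E.
Proof.
move=> l0; rewrite -(intA_chi mu alpha _ BB); apply: eq_intA => z Bz.
rewrite /chi; case: asboolP => zB; first exact: hfh.
have /andP[sz _] := hs Bz.
by rewrite abse0 mul0e poweR0r// gt_eqF// (lt_le_trans s1_gt0).
Qed.

Lemma measurable_modular (l : R) :
  measurable_fun B (fun z => h z * (l `^ (- s z))%:E)%E.
Proof.
apply: emeasurable_funM => //; apply/measurable_EFinP.
by apply: measurable_fun_powR2 => //; exact: measurable_funN.
Qed.

Lemma modular_ge0 (l : R) z : B z -> (0 <= h z * (l `^ (- s z))%:E)%E.
Proof. by move=> Bz; rewrite mule_ge0 ?h_ge0// lee_fin powR_ge0. Qed.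

Lemma modular_le_mass (l c : R) : 0 <= c ->
  (forall z, B z -> l `^ (- s z) <= c) ->
  (I (fun z => h z * (l `^ (- s z))%:E) <= c%:E * I h)%E.
Proof.
move=> c0 hc; rewrite -intAZl//; apply: le_intA => //.
- exact: measurable_modular.
- exact: emeasurable_funM.
- exact: modular_ge0.
- by move=> z Bz; rewrite muleC lee_wpmul2r ?h_ge0// lee_fin hc.
Qed.

Lemma mass_le_modular (l c : R) : 0 <= c ->
  (forall z, B z -> c <= l `^ (- s z)) ->
  (c%:E * I h <= I (fun z => h z * (l `^ (- s z))%:E))%E.
Proof.
move=> c0 hc; rewrite -intAZl//; apply: le_intA => //.
- exact: emeasurable_funM.
- exact: measurable_modular.
- by move=> z Bz; rewrite mule_ge0 ?lee_fin ?h_ge0.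
- by move=> z Bz; rewrite [leRHS]muleC lee_wpmul2r ?h_ge0// lee_fin hc.
Qed.

Lemma mass_lty_of_vnorm :
  (vnorm mu alpha s (chi B f) < +oo)%E -> (I h < +oo)%E.
Proof.
move=> /ereal_inf_lt[_ [l [l0 Il] <-] _].
rewrite vnorm_modular// in Il.
(* The maxima with 0 give one lower bound for l^(-s) whatever the sign of ln l. *)
pose c := expR (- (Num.max s2 0 * Num.max (ln l) 0)).
have c0 : 0 < c by exact: expR_gt0.
have hc z : B z -> c <= l `^ (- s z).
  move=> Bz; have /andP[h1 h2] := hs (BB Bz).
  rewrite powR_expR// ler_expR mulNr lerN2.
  have [? ?] : s2 <= Num.max s2 0 /\ ln l <= Num.max (ln l) 0.
    by rewrite !le_max !lexx.
  have ? : 0 <= Num.max (ln l) 0 by rewrite le_max lexx orbT.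
  apply: (@le_trans _ _ (s z * Num.max (ln l) 0)).
    by rewrite ler_wpM2l// (le_trans (ltW s1_gt0) h1).
  by rewrite ler_wpM2r// (le_trans h2).
have := le_trans (mass_le_modular (ltW c0) hc) Il.
have : (0 <= I h)%E by exact: intA_ge0.
case: (I h) => [r _ _|_|//]; first by rewrite ltry.
by rewrite gt0_muley ?lte_fin// leye_eq.
Qed.

(** With a = min(mass, 1), which is finite even if the mass is not, every admissible l is at least
    a^(1/s1): below it, l^(-s) >= l^(-s1) > 1/a and the modular exceeds 1. *)
Lemma vnorm_gt0_of_mass : (0 < I h)%E -> (0 < vnorm mu alpha s (chi B f))%E.
Proof.
move=> I0.
have [a a0 [a1 aI]] : exists2 a : R, 0 < a & a <= 1 /\ (a%:E <= I h)%E.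
  move: I0; case: (I h) => [r|_|//].
    rewrite lte_fin => r0; exists (Num.min r 1); first by rewrite lt_min r0 ltr01.
    by rewrite lee_fin !ge_min !lexx orbT.
  by exists 1 => //; rewrite leey.
apply: (@lt_le_trans _ _ (expR (ln a / s1))%:E); first by rewrite lte_fin expR_gt0.
apply: le_ereal_inf_tmp => _ [l [l0 Il] <-]; rewrite vnorm_modular// in Il.
rewrite lee_fin leNgt; apply/negP => hl.
have lnl : ln l < ln a / s1 by rewrite -ltr_expR lnK.
have lna : ln a <= 0 by rewrite ln_le0.
have lnl0 : ln l <= 0.
  by apply: le_trans (ltW lnl) _; rewrite pmulr_lle0// invr_gt0.
have hc z : B z -> expR (- (s1 * ln l)) <= l `^ (- s z).
  move=> Bz; have /andP[h1 h2] := hs (BB Bz).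
  by rewrite powR_expR// ler_expR mulNr lerN2 ler_wnM2r.
have := le_trans (mass_le_modular (expR_ge0 _) hc) Il; rewrite leNgt => /negP; apply.
apply: (@lt_le_trans _ _ ((expR (- (s1 * ln l)))%:E * a%:E)%E); last first.
  by rewrite lee_wpmul2l// lee_fin expR_ge0.
rewrite -EFinM lte_fin -{1}(lnK (x := a)) ?posrE// -expRD -[ltLHS]expR0 ltr_expR.
by move: lnl; rewrite ltr_pdivlMr//; lra.
Qed.

(** The norm equals a^(1/sigma) up to a factor exp(k/s1) either way. At l = a^(1/sigma), l^(-s) a
    differs from 1 by a factor of at most exp(k) either way; multiplying l by exp(k/s1) gains at
    least exp(k), because s >= s1. *)
Lemma vnorm_mass_bounds (a sigma k : R) : 0 < a -> I h = a%:E -> 0 < sigma ->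
  (forall z, B z -> `|s z / sigma - 1| * `|ln a| <= k) -> 0 <= k ->
  exists2 v : R, vnorm mu alpha s (chi B f) = (expR v)%:E &
    `|v - ln a / sigma| <= k / s1.
Proof.
move=> a0 Ia sg0 hk k0.
have hk' z : B z -> - k <= (s z / sigma - 1) * ln a <= k.
  by move=> /hk; rewrite -normrM ler_norml.
have hsz z : B z -> s1 <= s z by move=> /BB/hs/andP[].
have upper : (vnorm mu alpha s (chi B f) <= (expR (k / s1 + ln a / sigma))%:E)%E.
  apply: ereal_inf_lbound; exists (expR (k / s1 + ln a / sigma)) => //.
  split; first exact: expR_gt0.
  rewrite vnorm_modular ?expR_gt0//.
  have hc z : B z -> expR (k / s1 + ln a / sigma) `^ (- s z) <= expR (- ln a).
    move=> Bz; rewrite powR_expR ?expR_gt0// expRK ler_expR.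
    have /andP[h1 h2] := hk' z Bz; have h3 := hsz z Bz.
    have h4 : k <= s z * (k / s1).
      by rewrite mulrCA ler_peMr// ler_pdivlMr// mul1r.
    have -> : - s z * (k / s1 + ln a / sigma) =
      - (s z * (k / s1)) - (s z / sigma - 1) * ln a - ln a by ring.
    lra.
  apply: (le_trans (modular_le_mass (expR_ge0 _) hc)).
  by rewrite Ia -EFinM lee_fin -{2}(lnK (x := a)) ?posrE// -expRD addNr expR0.
have lower : ((expR (ln a / sigma - k / s1))%:E <= vnorm mu alpha s (chi B f))%E.
  apply: le_ereal_inf_tmp => _ [l [l0 Il] <-]; rewrite vnorm_modular// in Il.
  rewrite lee_fin leNgt; apply/negP => hl.
  (* [tau] is the logarithmic shortfall of l; it pushes the modular up to exp(s1 tau) > 1. *)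
  pose tau := ln a / sigma - k / s1 - ln l.
  have tau0 : 0 < tau by rewrite /tau subr_gt0 -ltr_expR lnK.
  have hc z : B z -> expR (s1 * tau - ln a) <= l `^ (- s z).
    move=> Bz; rewrite powR_expR// ler_expR.
    have /andP[h1 h2] := hk' z Bz; have h3 := hsz z Bz.
    have h4 : k <= s z * (k / s1).
      by rewrite mulrCA ler_peMr// ler_pdivlMr// mul1r.
    have h5 : s1 * tau <= s z * tau by rewrite ler_wpM2r// ltW.
    have -> : - s z * ln l = s z * tau + s z * (k / s1)
       - (s z / sigma - 1) * ln a - ln a by rewrite /tau; ring.
    lra.
  have := le_trans (mass_le_modular (expR_ge0 _) hc) Il.
  rewrite Ia -EFinM lee_fin -{2}(lnK (x := a)) ?posrE// -expRD subrK.
  by rewrite -[leRHS]expR0 ler_expR leNgt mulr_gt0.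
have : vnorm mu alpha s (chi B f) \is a fin_num.
  rewrite ge0_fin_numE; first by apply: (le_lt_trans upper); rewrite ltry.
  by apply: le_trans lower; rewrite lee_fin expR_ge0.
move: upper lower; case: (vnorm _ _ _ _) => // v; rewrite !lee_fin => hu hl _.
have v0 : 0 < v by apply: lt_le_trans hl; exact: expR_gt0.
exists (ln v); first by rewrite lnK.
have := hu; have := hl; rewrite -{1}(lnK (x := v)) ?posrE// ler_expR => h1.
rewrite -{1}(lnK (x := v)) ?posrE// ler_expR => h2.
by rewrite ler_norml; apply/andP; split; lra.
Qed.

End VariableNorm.

(** * Weights *)

(** Positivity cannot be dropped: 0 times +oo is 0. *)
Lemma mule_lt_pinfty_gt0 (R : realType) (x y : \bar R) :
  (0 < x)%E -> (0 < y)%E -> (x * y < +oo)%E -> (x < +oo)%E /\ (y < +oo)%E.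
Proof.
move: x y => [x||] [y||] //= x0 y0; rewrite ?ltry//.
- by rewrite gt0_muley.
- by rewrite gt0_mulye.
Qed.

Lemma npow_gt0 (R : realType) (x s : R) : 0 <= x -> (0 < npow x s)%E.
Proof.
rewrite /npow; case: eqP => [//|/eqP xN x0].
by rewrite lte_fin powR_gt0// lt_neqAle eq_sym xN.
Qed.

(** At x = 0 both sides are +oo, so zeros of the weight need no separate treatment later. *)
Lemma npow_modular (R : realType) (x e s l : R) : 0 <= x -> 0 < s -> 0 < l ->
  ((`|npow x e| * (l^-1)%:E) `^ s = npow x (e * s) * (l `^ (- s))%:E)%E.
Proof.
move=> x0 s0 l0; have il0 : 0 < l^-1 by rewrite invr_gt0.
rewrite gee0_abs ?ltW ?npow_gt0// /npow; case: eqP => [_|_].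
  rewrite gt0_mulye ?lte_fin// poweRyr ?gt_eqF// gt0_mulye//.
  by rewrite lte_fin powR_gt0.
rewrite -EFinM/= -EFinM powRM ?powR_ge0 ?ltW// -powRrM mulNr.
by rewrite -(powR_inv1 (ltW l0)) -powRrM mulN1r.
Qed.

Lemma powR_modular (R : realType) (x s l : R) : 0 <= x -> 0 < s -> 0 < l ->
  ((`|(x `^ s^-1)%:E| * (l^-1)%:E) `^ s = x%:E * (l `^ (- s))%:E)%E.
Proof.
move=> x0 s0 l0; rewrite abse_EFin ger0_norm ?powR_ge0// -EFinM/= -EFinM.
rewrite powRM ?powR_ge0 ?invr_ge0 ?ltW// -powRrM mulVf ?gt_eqF// powRr1//.
by rewrite -(powR_inv1 (ltW l0)) -powRrM mulN1r.
Qed.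

(* A dichotomy on the sign of [p t + ln x] replaces Young's inequality. *)
Lemma young_npow (R : realType) (x p t : R) : 0 <= x -> 1 < p ->
  (1 <= (expR (p * t))%:E * x%:E +
    (expR (- (p / (p - 1) * t)))%:E * npow x (p / (p - 1) - 1))%E.
Proof.
move=> x0 p1; have p0 : 0 < p - 1 by lra.
rewrite /npow; case: eqP => [_|/eqP xN].
  by rewrite gt0_muley ?lte_fin ?expR_gt0// -EFinM addey ?leey.
have xpos : 0 < x by rewrite lt_neqAle eq_sym xN.
rewrite powR_expR// -!EFinM -EFinD lee_fin -{1}(lnK (x := x)) ?posrE// -!expRD.
have -> : - (p / (p - 1) * t) + - (p / (p - 1) - 1) * ln x =
   - ((p * t + ln x) / (p - 1)) by field; rewrite gt_eqF.
case: (leP 0 (p * t + ln x)) => h.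
  apply: ler_wpDr; first exact: expR_ge0.
  by rewrite -[leLHS]expR0 ler_expR.
apply: ler_wpDl; first exact: expR_ge0.
rewrite -[leLHS]expR0 ler_expR oppr_ge0 pmulr_lle0 ?invr_gt0//; exact: ltW.
Qed.

(* [tau = ln (1 + 2 b / m)] makes the second term at most [m / 2]. *)
Lemma log_mass_bound (R : realType) (q m0 a0 b : R) :
  0 <= q -> 0 < m0 -> 0 < b -> exists2 K : R, 0 <= K & forall m a : R,
  0 < m -> m <= m0 -> a <= a0 ->
  (forall tau, 0 <= tau -> m <= expR (q * tau) * a + expR (- tau) * b) ->
  0 < a /\ `|ln a| <= K * (1 + `|ln m|).
Proof.
move=> q0 m00 b0.
pose K := `|ln a0| + `|ln 2| + 1 + q * (`|ln (m0 + 2 * b)| + 1).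
have K0 : 0 <= K by rewrite !addr_ge0// mulr_ge0// addr_ge0.
exists K => // m a mp mm0 aa0 hm.
have mb : 0 < m + 2 * b by rewrite addr_gt0// mulr_gt0.
pose tau := ln (m + 2 * b) - ln m.
have tau0 : 0 <= tau.
  by rewrite subr_ge0 ler_ln ?posrE// lerDl mulr_ge0// ltW.
have h1 : expR (- tau) * b <= m / 2.
  rewrite /tau opprB expRD expRN !lnK ?posrE// mulrAC ler_pdivrMr//; nra.
have h2 : m / 2 <= expR (q * tau) * a by have := hm _ tau0; lra.
have apos : 0 < a.
  rewrite -(pmulr_rgt0 _ (expR_gt0 (q * tau))); apply: lt_le_trans h2; lra.
split => //.
have h3 : ln m - ln 2 <= q * tau + ln a.
  have m2 : 0 < m / 2 by lra.
  by move: h2; rewrite -ler_ln ?posrE ?mulr_gt0 ?expR_gt0// ln_div ?posrE//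
    lnM ?posrE ?expR_gt0// expRK.
have h4 : ln (m + 2 * b) <= `|ln (m0 + 2 * b)|.
  apply: le_trans (ler_norm _); rewrite ler_ln ?posrE// ?lerD2r//.
  by rewrite addr_gt0// mulr_gt0.
have h5 : ln a <= `|ln a0|.
  by apply: le_trans (ler_norm _); rewrite ler_ln ?posrE// (lt_le_trans apos).
have h6 : - ln m <= `|ln m| by rewrite -normrN ler_norm.
have h7 : ln 2 <= `|ln 2 : R| by exact: ler_norm.
set X := `|ln m| in h6 *; have X0 : 0 <= X by exact: normr_ge0.
set Y := `|ln (m0 + 2 * b)| in h4 K K0 *; have Y0 : 0 <= Y by exact: normr_ge0.
have h8 : q * tau <= q * ((Y + 1) * (1 + X)).
  by rewrite ler_wpM2l// /tau; nra.
set Z := `|ln a0| in h5 K K0 *; have Z0 : 0 <= Z by exact: normr_ge0.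
set W := `|ln 2| in h7 K K0 *; have W0 : 0 <= W by exact: normr_ge0.
have h9 : Z + W + X <= (Z + W + 1) * (1 + X) by nra.
have q8 : 0 <= q * ((Y + 1) * (1 + X)) by rewrite !mulr_ge0// addr_ge0.
have KE : K * (1 + X) = (Z + W + 1) * (1 + X) + q * ((Y + 1) * (1 + X)).
  by rewrite /K; ring.
by rewrite ler_norml KE; apply/andP; split; lra.
Qed.

Section Weights.
Variables (R : realType) (n : nat).
Local Notation T := (Cn R n).
Variables (mu : {measure set T -> \bar R}) (alpha : R) (p w : T -> R).
Hypothesis n_gt0 : (0 < n)%N.
Hypothesis hmu : is_normalized_volume mu.
Hypothesis alpha_gt0 : 0 < alpha.
Hypothesis hp : Plog mu p.
Hypothesis hw : is_weight mu alpha w.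
Hypothesis w_neq0 : ~ ae_zero mu w.

Variables (pm pM : R).
Hypothesis pm_gt1 : 1 < pm.
Hypothesis p_ge : forall z, Ball z -> pm <= p z.
Hypothesis p_le : forall z, Ball z -> p z <= pM.

Local Notation BT := (@Ball R n).
Local Notation I := (intA mu alpha).
Local Notation mA B := (fine (muA mu alpha B)).

Let wE (z : T) : \bar R := (w z)%:E.
Let dualw (z : T) : \bar R := npow (w z) (pconj p z - 1).

Let mp : measurable_fun BT p. Proof. by case: hp. Qed.
Let mw : measurable_fun BT w. Proof. by case: hw => _ []. Qed.
Let w_ge0 z : Ball z -> 0 <= w z. Proof. by case: hw => h _; exact: h. Qed.
Let mBall : measurable BT. Proof. exact: measurable_Ball. Qed.

Lemma measurable_pconj : measurable_fun BT (pconj p).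
Proof.
by apply: measurable_funM => //; apply: measurable_fun_inv; exact: measurable_funB.
Qed.

Lemma measurable_dualw : measurable_fun BT dualw.
Proof.
have m0 : measurable_fun BT (fun z => w z == 0) by exact: measurable_fun_eqr.
apply: measurable_fun_if => //.
apply: (@measurable_funS _ _ _ _ BT) => //.
apply/measurable_EFinP; apply: measurable_fun_powR2 => //.
by apply: measurable_funN; apply: measurable_funB => //; exact: measurable_pconj.
Qed.

Lemma wE_ge0 z : Ball z -> (0 <= wE z)%E.
Proof. by move=> Bz; rewrite lee_fin w_ge0. Qed.

Lemma dualw_gt0 z : Ball z -> (0 < dualw z)%E.
Proof. by move=> Bz; exact: npow_gt0 (w_ge0 Bz). Qed.

Lemma dualw_ge0 z : Ball z -> (0 <= dualw z)%E.
Proof. by move=> /dualw_gt0/ltW. Qed.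

Lemma mass_w_gt0 : (0 < I BT wE)%E.
Proof.
rewrite lt_neqAle intA_ge0 ?andbT; last exact: wE_ge0.
apply/eqP => /esym I0; apply: w_neq0.
have mwE : measurable_fun BT wE by apply/measurable_EFinP.
apply: filterS (intA_eq0 mBall (@subset_refl _ _) mwE wE_ge0 I0) => z h Bz.
by have := h Bz; rewrite /wE => -[].
Qed.

(** w' is positive at every point of the ball, infinite where w vanishes, so a zero integral would
    make the ball a null set. *)
Lemma mass_dualw_gt0 : (0 < I BT dualw)%E.
Proof.
rewrite lt_neqAle intA_ge0 ?andbT; last exact: dualw_ge0.
apply/eqP => /esym I0.
have [N [mN N0 hN]] := intA_eq0 mBall (@subset_refl _ _) measurable_dualw dualw_ge0 I0.
have : (mu BT <= mu N)%E.
  apply: le_measure; rewrite ?inE// => z Bz; apply: hN => /= h.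
  by have := dualw_gt0 Bz; rewrite h// ltxx.
by rewrite hmu.2 N0 lee_fin ler10.
Qed.

Lemma pconj_bounds z : Ball z -> 1 <= pconj p z <= pm / (pm - 1).
Proof.
move=> Bz; have pm1 := pm_gt1; have h1 := p_ge Bz; have pz : 0 < p z - 1 by lra.
have pm0 : 0 < pm - 1 by lra.
rewrite /pconj; apply/andP; split; first by rewrite ler_pdivlMr//; lra.
by rewrite ler_pdivrMr// mulrAC ler_pdivlMr//; lra.
Qed.

(** This identity makes w' the mass density both of w^(-1/p) with exponent p' and of w^(-1) with
    exponent p'/p. *)
Lemma pconj_div z : Ball z -> pconj p z / p z = pconj p z - 1.
Proof.
move=> Bz; have pm1 := pm_gt1; have h1 := p_ge Bz; rewrite /pconj; field.
by apply/andP; split; rewrite gt_eqF//; lra.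
Qed.

Lemma pconj_sub1 z : Ball z -> pconj p z - 1 = (p z - 1)^-1.
Proof.
move=> Bz; have pm1 := pm_gt1; have h1 := p_ge Bz; rewrite /pconj; field.
by rewrite gt_eqF//; lra.
Qed.

Lemma pconj_div_bounds z : Ball z -> pM^-1 <= pconj p z / p z <= (pm - 1)^-1.
Proof.
move=> Bz; have pm1 := pm_gt1; have h1 := p_ge Bz; have h2 := p_le Bz.
by rewrite pconj_div// pconj_sub1// !lef_pV2 ?posrE; lra.
Qed.

Lemma pB_in (B : set T) : Bfam B -> pm <= pB mu alpha p B <= pM.
Proof.
move=> hB; apply: (pB_bounds n_gt0 hmu alpha_gt0 hp) => //; first exact: lt_trans pm_gt1.
by move=> z /(Bfam_subset hB) Bz; rewrite p_ge// p_le.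
Qed.

Lemma pM_gt0 : 0 < pM.
Proof.
by have := p_ge (@Ball_origin R n); have := p_le (@Ball_origin R n); have := pm_gt1; lra.
Qed.

Section OneSet.
Variable B : set T.
Hypothesis hB : Bfam B.

Let mB : measurable B. Proof. exact: measurable_Bfam. Qed.
Let BB : B `<=` BT. Proof. exact: Bfam_subset. Qed.
Let mpB : measurable_fun B p. Proof. exact: measurable_funS mp. Qed.
Let mpcB : measurable_fun B (pconj p). Proof. exact: measurable_funS measurable_pconj. Qed.
Let mwB : measurable_fun B wE.
Proof. by apply/measurable_EFinP; exact: measurable_funS mw. Qed.
Let mdB : measurable_fun B dualw. Proof. exact: measurable_funS measurable_dualw. Qed.
Let wB0 z : B z -> (0 <= wE z)%E. Proof. by move=> /BB; exact: wE_ge0. Qed.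
Let dB0 z : B z -> (0 <= dualw z)%E. Proof. by move=> /BB; exact: dualw_ge0. Qed.

Definition normw := vnorm mu alpha p (chi B (fun z => (w z `^ (p z)^-1)%:E)).
Definition normdual :=
  vnorm mu alpha (pconj p) (chi B (fun z => npow (w z) (p z)^-1)).
Definition norminv :=
  vnorm mu alpha (fun z => (pconj p z / p z)%R) (chi B (fun z => npow (w z) 1)).

Lemma normw_modular z l : B z -> 0 < l ->
  ((`|(w z `^ (p z)^-1)%:E| * (l^-1)%:E) `^ p z = wE z * (l `^ (- p z))%:E)%E.
Proof.
move=> /BB Bz l0; apply: powR_modular => //; first exact: w_ge0.
exact: lt_trans ltr01 (lt_le_trans pm_gt1 (p_ge Bz)).
Qed.

Lemma normdual_modular z l : B z -> 0 < l ->
  ((`|npow (w z) (p z)^-1| * (l^-1)%:E) `^ pconj p z =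
   dualw z * (l `^ (- pconj p z))%:E)%E.
Proof.
move=> /BB Bz l0; have pc0 : 0 < pconj p z.
  by have /andP[h _] := pconj_bounds Bz; exact: lt_le_trans ltr01 h.
by rewrite npow_modular ?w_ge0// mulrC pconj_div.
Qed.

Lemma norminv_modular z l : B z -> 0 < l ->
  ((`|npow (w z) 1| * (l^-1)%:E) `^ (pconj p z / p z) =
   dualw z * (l `^ (- (pconj p z / p z)))%:E)%E.
Proof.
move=> /BB Bz l0; rewrite npow_modular ?w_ge0//.
  by rewrite mul1r pconj_div.
by have /andP[h _] := pconj_div_bounds Bz; apply: lt_le_trans h; rewrite invr_gt0 pM_gt0.
Qed.

Let hp1 z : Ball z -> 1 <= p z <= pM.
Proof. by move=> Bz; rewrite p_le// andbT (le_trans (ltW pm_gt1))// p_ge. Qed.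

Let pMi_gt0 : 0 < pM^-1. Proof. by rewrite invr_gt0 pM_gt0. Qed.

Let mratio : measurable_fun B (fun z => pconj p z / p z).
Proof. by apply: measurable_funM => //; exact: measurable_fun_inv. Qed.

Lemma normw_lty : (normw < +oo)%E -> (I B wE < +oo)%E.
Proof. exact: (mass_lty_of_vnorm mB BB mpB mwB ltr01 hp1 wB0 normw_modular). Qed.

Lemma normw_gt0 : (0 < I B wE)%E -> (0 < normw)%E.
Proof. exact: (vnorm_gt0_of_mass mB BB mpB mwB ltr01 hp1 wB0 normw_modular). Qed.

Lemma normdual_lty : (normdual < +oo)%E -> (I B dualw < +oo)%E.
Proof. exact: (mass_lty_of_vnorm mB BB mpcB mdB ltr01 pconj_bounds dB0 normdual_modular). Qed.

Lemma normdual_gt0 : (0 < I B dualw)%E -> (0 < normdual)%E.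
Proof. exact: (vnorm_gt0_of_mass mB BB mpcB mdB ltr01 pconj_bounds dB0 normdual_modular). Qed.

Lemma norminv_lty : (norminv < +oo)%E -> (I B dualw < +oo)%E.
Proof.
exact: (mass_lty_of_vnorm mB BB mratio mdB pMi_gt0 pconj_div_bounds dB0
  norminv_modular).
Qed.

Lemma norminv_gt0 : (0 < I B dualw)%E -> (0 < norminv)%E.
Proof.
exact: (vnorm_gt0_of_mass mB BB mratio mdB pMi_gt0 pconj_div_bounds dB0
  norminv_modular).
Qed.

End OneSet.

(** * Integrability of w and w' from each of the three conditions *)

Lemma mA_gt0 (B : set T) : Bfam B -> 0 < mA B.
Proof. by move=> /(muA_Bfam_fin n_gt0 hmu alpha_gt0)[/andP[]]. Qed.

Let bBall : Bfam BT. Proof. exact: Bfam_Ball. Qed.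

Lemma in_B_masses_lty : in_B mu alpha p w ->
  (I BT wE < +oo)%E /\ (I BT dualw < +oo)%E.
Proof.
move=> [M /(_ _ bBall)]; rewrite -/(normw BT) -/(normdual BT) => hM.
have hN1 := normw_gt0 bBall mass_w_gt0.
have hN2 := normdual_gt0 bBall mass_dualw_gt0.
have m0 : (0 < ((mA BT)^-1)%:E)%E by rewrite lte_fin invr_gt0 mA_gt0.
have := le_lt_trans hM (ltry M).
move=> /(mule_lt_pinfty_gt0 (mule_gt0 m0 hN1) hN2)[].
move=> /(mule_lt_pinfty_gt0 m0 hN1)[_ h1] h2.
by split; [exact: normw_lty bBall h1|exact: normdual_lty bBall h2].
Qed.

Lemma in_Bplus_masses_lty : in_Bplus mu alpha p w ->
  (I BT wE < +oo)%E /\ (I BT dualw < +oo)%E.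
Proof.
move=> [M /(_ _ bBall)]; rewrite -/(norminv BT) -/wE => hM.
have hN := norminv_gt0 bBall mass_dualw_gt0; have hw0 := mass_w_gt0.
have m0 : (0 < ((mA BT) `^ (- pB mu alpha p BT))%:E)%E.
  by rewrite lte_fin powR_gt0// mA_gt0.
have := le_lt_trans hM (ltry M).
move=> /(mule_lt_pinfty_gt0 (mule_gt0 m0 hw0) hN)[].
move=> /(mule_lt_pinfty_gt0 m0 hw0)[_ h1] h2.
by split => //; exact: norminv_lty bBall h2.
Qed.

Lemma in_Bplusplus_masses_lty : in_Bplusplus mu alpha p w ->
  (I BT wE < +oo)%E /\ (I BT dualw < +oo)%E.
Proof.
move=> [M /(_ _ bBall)]; rewrite -/wE -/dualw => hM.
have hd0 := mass_dualw_gt0; have hw0 := mass_w_gt0.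
have m0 : (0 < ((mA BT)^-1)%:E)%E by rewrite lte_fin invr_gt0 mA_gt0.
(* A zero exponent would lose all information on the dual mass. *)
have pB1 : pB mu alpha p BT - 1 != 0.
  have /andP[h _] := pB_in bBall.
  by rewrite gt_eqF// subr_gt0 (lt_le_trans pm_gt1).
have hp0 := poweR_gt0 (pB mu alpha p BT - 1) (mule_gt0 hd0 m0).
have := le_lt_trans hM (ltry M).
move=> /(mule_lt_pinfty_gt0 (mule_gt0 hw0 m0) hp0)[].
move=> /(mule_lt_pinfty_gt0 hw0 m0)[h1 _].
by move=> /(lty_poweRy pB1)/(mule_lt_pinfty_gt0 hd0 m0)[].
Qed.

(** * Logarithmic comparison of the three quantities *)

Section FiniteMasses.
Hypothesis w_lty : (I BT wE < +oo)%E.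
Hypothesis dualw_lty : (I BT dualw < +oo)%E.

Lemma mass_fin (B : set T) (g : T -> \bar R) : Bfam B -> measurable_fun BT g ->
  (forall z, Ball z -> 0 <= g z)%E -> (I BT g < +oo)%E ->
  I B g = (fine (I B g))%:E /\ fine (I B g) <= fine (I BT g).
Proof.
move=> hB mg g0 glty.
have mB := measurable_Bfam hB; have BB := Bfam_subset hB.
have leB : (I B g <= I BT g)%E by exact: intA_subset.
have gB0 : (0 <= I B g)%E by apply: intA_ge0 => z /BB; exact: g0.
have finB : I B g \is a fin_num by rewrite ge0_fin_numE// (le_lt_trans leB).
rewrite fineK//; split => //; apply: fine_le => //.
by rewrite ge0_fin_numE// (le_trans gB0).
Qed.

Lemma young_mass (B : set T) (c1 c2 : R) : Bfam B -> 0 <= c1 -> 0 <= c2 ->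
  (forall z, Ball z -> 1 <= c1%:E * wE z + c2%:E * dualw z)%E ->
  mA B <= c1 * fine (I B wE) + c2 * fine (I B dualw).
Proof.
move=> hB c10 c20 hc.
have mB := measurable_Bfam hB; have BB := Bfam_subset hB.
have mwE : measurable_fun BT wE by apply/measurable_EFinP.
have [aE _] := mass_fin hB mwE wE_ge0 w_lty.
have [bE _] := mass_fin hB measurable_dualw dualw_ge0 dualw_lty.
have [_ mE] := muA_Bfam_fin n_gt0 hmu alpha_gt0 hB.
have mwB : measurable_fun B wE by exact: measurable_funS mwE.
have mdB : measurable_fun B dualw by exact: measurable_funS measurable_dualw.
have wB0 z : B z -> (0 <= wE z)%E by move=> /BB; exact: wE_ge0.
have dB0 z : B z -> (0 <= dualw z)%E by move=> /BB; exact: dualw_ge0.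
rewrite -lee_fin -mE EFinD !EFinM -aE -bE -!intAZl// -intAD//.
- apply: le_intA => //; last by move=> z /BB; exact: hc.
  by apply: emeasurable_funD; exact: emeasurable_funM.
- exact: emeasurable_funM.
- exact: emeasurable_funM.
- by move=> z Bz; rewrite mule_ge0 ?wB0.
- by move=> z Bz; rewrite mule_ge0 ?dB0.
Qed.

Lemma log_masses : exists2 K : R, 0 <= K & forall B : set T, Bfam B ->
  [/\ 0 < fine (I B wE), 0 < fine (I B dualw),
      `|ln (fine (I B wE))| <= K * (1 + `|ln (mA B)|) &
      `|ln (fine (I B dualw))| <= K * (1 + `|ln (mA B)|)].
Proof.
have mwE : measurable_fun BT wE by apply/measurable_EFinP.
have a00 : 0 < fine (I BT wE) by rewrite fine_gt0// mass_w_gt0.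
have b00 : 0 < fine (I BT dualw) by rewrite fine_gt0// mass_dualw_gt0.
have pm1 : 0 < pm - 1 by rewrite subr_gt0.
have pm0 : 0 < pm by exact: lt_trans pm_gt1.
(* [young_npow] at t = tau weights w by at most exp(pM tau) and w' by at most exp(-tau), since p <=
   pM and p' >= 1. This bounds a below, with the total mass of w' as b. *)
have [K1 K10 hK1] := log_mass_bound (fine (I BT wE)) (ltW pM_gt0) (mA_gt0 bBall) b00.
have q0 : 0 <= pm / (pm - 1) by rewrite divr_ge0// ltW.
have [K2 K20 hK2] := log_mass_bound (fine (I BT dualw)) q0 (mA_gt0 bBall) a00.
exists (K1 + K2); first exact: addr_ge0.
move=> B hB.
have [/andP[m0 mm0] _] := muA_Bfam_fin n_gt0 hmu alpha_gt0 hB.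
have [_ aa0] := mass_fin hB mwE wE_ge0 w_lty.
have [_ bb0] := mass_fin hB measurable_dualw dualw_ge0 dualw_lty.
have X0 : 0 <= 1 + `|ln (mA B)| by rewrite addr_ge0.
have expE z t : Ball z -> (1 <= (expR (p z * t))%:E * wE z +
    (expR (- (pconj p z * t)))%:E * dualw z)%E.
  by move=> Bz; apply: young_npow; rewrite ?w_ge0// (lt_le_trans pm_gt1)// p_ge.
have [|a0 ha] := hK1 _ _ m0 mm0 aa0.
  move=> tau tau0.
  apply: (@le_trans _ _ (expR (pM * tau) * fine (I B wE) +
                         expR (- tau) * fine (I B dualw))); last first.
    by rewrite lerD2l ler_wpM2l ?expR_ge0.
  apply: young_mass; rewrite ?expR_ge0// => z Bz.
  apply: le_trans (expE z tau Bz) _; apply: leeD; apply: lee_wpmul2r.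
  - exact: wE_ge0.
  - by rewrite lee_fin ler_expR ler_wpM2r// p_le.
  - exact: dualw_ge0.
  - rewrite lee_fin ler_expR lerN2 -[leLHS]mul1r ler_wpM2r//.
    by have /andP[] := pconj_bounds Bz.
have [|b0 hb] := hK2 _ _ m0 mm0 bb0.
  (* The dual bound takes t = -tau: now w' is weighted by the growing exponential, with p' <= pm /
     (pm - 1), and w decays because p >= 1. *)
  move=> tau tau0.
  apply: (@le_trans _ _ (expR (- tau) * fine (I B wE) +
            expR (pm / (pm - 1) * tau) * fine (I B dualw))); last first.
    by rewrite addrC lerD2l ler_wpM2l ?expR_ge0.
  apply: young_mass; rewrite ?expR_ge0// => z Bz.
  apply: le_trans (expE z (- tau) Bz) _; apply: leeD; apply: lee_wpmul2r.
  - exact: wE_ge0.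
  - rewrite lee_fin ler_expR mulrN lerN2 -[leLHS]mul1r ler_wpM2r//.
    by rewrite (le_trans (ltW pm_gt1))// p_ge.
  - exact: dualw_ge0.
  - rewrite lee_fin ler_expR mulrN opprK ler_wpM2r//.
    by have /andP[] := pconj_bounds Bz.
split => //.
  by apply: le_trans ha _; rewrite ler_wpM2r// lerDl.
by apply: le_trans hb _; rewrite ler_wpM2r// lerDr.
Qed.

(** Y1, Y2 and X are the logarithms of the [in_B], [in_Bplus] and [in_Bplusplus] quantities; c does
    not depend on B. *)
Lemma log_comparison : exists2 c : R, 0 <= c & forall B : set T, Bfam B ->
  exists X Y1 Y2 : R, [/\
    (((mA B)^-1)%:E * normw B * normdual B = (expR Y1)%:E)%E,
    (((mA B) `^ (- pB mu alpha p B))%:E * I B wE * norminv B = (expR Y2)%:E)%E,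
    (I B wE * ((mA B)^-1)%:E * ((I B dualw * ((mA B)^-1)%:E)
       `^ (pB mu alpha p B - 1)%R) = (expR X)%:E)%E,
    `|Y1 - X / pB mu alpha p B| <= c & `|Y2 - X| <= c].
Proof.
have mwE : measurable_fun BT wE by apply/measurable_EFinP.
have [K K0 hK] := log_masses.
have [k k0 hk] := pB_oscillation n_gt0 hmu alpha_gt0 hp.
have pm1 : 0 < pm - 1 by rewrite subr_gt0.
have pM0 := pM_gt0.
(* One constant for three relative errors: (p - q)/q for p, and (p - q)/(p - 1), possibly divided by
   q, for p' and p'/p; hence the factor 1/(pm - 1). *)
pose kap := k * K * (1 + (pm - 1)^-1).
have kK0 : 0 <= k * K by exact: mulr_ge0.
have i0 : 0 <= (pm - 1)^-1 by rewrite invr_ge0 ltW.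
have kap0 : 0 <= kap by rewrite mulr_ge0// addr_ge0.
have kap1 : k * K <= kap by rewrite ler_peMr// lerDl.
have kap2 : k * K / (pm - 1) <= kap by rewrite ler_wpM2l// lerDr.
(* Y1 involves two norms with exponents at least 1, each with error [kap]; Y2 involves one with
   exponent at least 1/pM. *)
exists (2 * kap + kap * pM); first by rewrite addr_ge0// mulr_ge0// ltW.
move=> B hB; have [a0 b0 ha hb] := hK B hB.
have mB := measurable_Bfam hB; have BB := Bfam_subset hB.
have [aE _] := mass_fin hB mwE wE_ge0 w_lty.
have [bE _] := mass_fin hB measurable_dualw dualw_ge0 dualw_lty.
have m0 := mA_gt0 hB.
set a := fine (I B wE) in a0 ha aE; set b := fine (I B dualw) in b0 hb bE.
set m := mA B in ha hb m0 *; set q := pB mu alpha p B.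
have /andP[q1 q2] := pB_in hB; rewrite -/q in q1 q2.
have q1' : 0 < q - 1 by rewrite subr_gt0 (lt_le_trans pm_gt1).
have q0 : 0 < q by rewrite (lt_trans _ (lt_le_trans pm_gt1 q1)).
have X0 : 0 < 1 + `|ln m| by rewrite ltr_pwDl.
have osc (z : T) (x : R) : B z -> `|x| <= K * (1 + `|ln m|) -> `|p z - q| * `|x| <= k * K.
  move=> Bz hx; apply: (@le_trans _ _ (`|p z - q| * (K * (1 + `|ln m|)))).
    by rewrite ler_wpM2l.
  by rewrite mulrCA mulrC ler_wpM2r// hk.
have pz z : B z -> [/\ pm - 1 <= p z - 1, 0 < p z - 1 & 0 < p z].
  move=> /BB Bz; have h := p_ge Bz; have h' := pm_gt1.
  by split; lra.
have c1 z : B z -> `|p z / q - 1| * `|ln a| <= kap.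
  move=> Bz; apply: le_trans kap1; apply: le_trans (osc _ _ Bz ha).
  rewrite (_ : p z / q - 1 = (p z - q) / q); last by field; rewrite gt_eqF.
  rewrite normrM ler_wpM2r// ler_piMr// normfV gtr0_norm// invf_le1//.
  by rewrite (le_trans (ltW pm_gt1)).
have osc1 z : B z -> `|(p z - q) / (p z - 1)| * `|ln b| <= kap.
  move=> Bz; have [h1 h2 h3] := pz z Bz; apply: le_trans kap2.
  rewrite normrM mulrAC normfV (gtr0_norm h2).
  apply: ler_pM; rewrite ?mulr_ge0 ?invr_ge0 ?(ltW h2)//; first exact: osc.
  by rewrite lef_pV2 ?posrE.
have c2 z : B z -> `|pconj p z / (q / (q - 1)) - 1| * `|ln b| <= kap.
  move=> Bz; have [h1 h2 h3] := pz z Bz; apply: le_trans (osc1 z Bz).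
  rewrite ler_wpM2r//.
  rewrite (_ : _ - 1 = - ((p z - q) / (p z - 1)) / q); last first.
    by rewrite /pconj; field; rewrite !gt_eqF.
  rewrite normrM normrN ler_piMr// normfV gtr0_norm// invf_le1//.
  by rewrite (le_trans (ltW pm_gt1)).
have c3 z : B z -> `|(pconj p z / p z) / (q - 1)^-1 - 1| * `|ln b| <= kap.
  move=> Bz; have [h1 h2 h3] := pz z Bz; apply: le_trans (osc1 z Bz).
  rewrite ler_wpM2r// -[leRHS]normrN pconj_div ?pconj_sub1; try exact: BB.
  rewrite le_eqVlt; apply/orP; left; apply/eqP; congr (`| _ |).
  by field; rewrite !gt_eqF.
have mpB : measurable_fun B p by exact: measurable_funS mp.
have mpcB : measurable_fun B (pconj p) by exact: measurable_funS measurable_pconj.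
have mwB : measurable_fun B wE by exact: measurable_funS mwE.
have mdB : measurable_fun B dualw by exact: measurable_funS measurable_dualw.
have wB0 z : B z -> (0 <= wE z)%E by move=> /BB; exact: wE_ge0.
have dB0 z : B z -> (0 <= dualw z)%E by move=> /BB; exact: dualw_ge0.
have hp1 z : Ball z -> 1 <= p z <= pM.
  by move=> Bz; rewrite p_le// andbT (le_trans (ltW pm_gt1))// p_ge.
have mratio : measurable_fun B (fun z => pconj p z / p z).
  by apply: measurable_funM => //; exact: measurable_fun_inv.
have pMi_gt0 : 0 < pM^-1 by rewrite invr_gt0.
have s20 : 0 < q / (q - 1) by rewrite divr_gt0.
have s30 : 0 < (q - 1)^-1 by rewrite invr_gt0.
have [v1 v1E v1h] := vnorm_mass_bounds mB BB mpB mwB ltr01 hp1 wB0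
  (normw_modular hB) a0 aE q0 c1 kap0.
have [v2 v2E v2h] := vnorm_mass_bounds mB BB mpcB mdB ltr01 pconj_bounds dB0
  (normdual_modular hB) b0 bE s20 c2 kap0.
have [v3 v3E v3h] := vnorm_mass_bounds mB BB mratio mdB pMi_gt0 pconj_div_bounds dB0
  (norminv_modular hB) b0 bE s30 c3 kap0.
exists (ln a - ln m + (q - 1) * (ln b - ln m)), (- ln m + v1 + v2),
  (- q * ln m + ln a + v3); split.
- rewrite /normw v1E /normdual v2E -!EFinM; congr EFin.
  by rewrite !expRD expRN lnK.
- rewrite /norminv v3E aE -!EFinM; congr EFin.
  by rewrite !expRD powR_expR// (lnK (x := a)).
- rewrite aE bE -!EFinM/= -?EFinM; congr EFin.
  rewrite powR_expR ?divr_gt0// ln_div ?posrE// expRD expRB !lnK ?posrE//.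
- have kpM : 0 <= kap * pM by rewrite mulr_ge0// ltW.
  (* The powers of m cancel because 1/q + (q - 1)/q = 1. *)
  have -> : - ln m + v1 + v2 - (ln a - ln m + (q - 1) * (ln b - ln m)) / q =
     (v1 - ln a / q) + (v2 - ln b / (q / (q - 1))).
    by field; rewrite !gt_eqF.
  apply: le_trans (ler_normD _ _) _; rewrite invr1 mulr1 in v1h v2h; lra.
- have -> : - q * ln m + ln a + v3 - (ln a - ln m + (q - 1) * (ln b - ln m)) =
     v3 - ln b / (q - 1)^-1 by rewrite invrK; ring.
  rewrite (invrK pM) in v3h; lra.
Qed.

End FiniteMasses.

(** In terms of the quantities, G <= exp(D) max(F, 1)^C. The positive part is needed because the
    logarithms may be very negative while the power relating them, p_B or its inverse, varies with
    B. *)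
Lemma bounded_transfer (F G : set T -> \bar R) (C D : R) : 0 <= C ->
  (forall B, Bfam B -> exists f g : R, [/\ F B = (expR f)%:E, G B = (expR g)%:E &
     g <= C * Num.max f 0 + D]) ->
  (exists M : R, forall B, Bfam B -> (F B <= M%:E)%E) ->
  exists M : R, forall B, Bfam B -> (G B <= M%:E)%E.
Proof.
move=> C0 hFG [M hM]; exists (expR (C * ln (Num.max M 1) + D)) => B hB.
have [f [g [FE -> gf]]] := hFG B hB; rewrite lee_fin ler_expR.
apply: le_trans gf _; rewrite lerD2r ler_wpM2l//.
have M1 : 1 <= Num.max M 1 by rewrite le_max lexx orbT.
rewrite ge_max ln_ge0// andbT -ler_expR lnK ?posrE ?(lt_le_trans ltr01)//.
by rewrite le_max; have := hM B hB; rewrite FE lee_fin => ->.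
Qed.

Lemma in_B_equivalences :
  (in_B mu alpha p w <-> in_Bplus mu alpha p w) /\
  (in_Bplus mu alpha p w <-> in_Bplusplus mu alpha p w).
Proof.
pose F1 B := (((mA B)^-1)%:E * normw B * normdual B)%E.
pose F2 B := (((mA B) `^ (- pB mu alpha p B))%:E * I B wE * norminv B)%E.
pose F3 B := (I B wE * ((mA B)^-1)%:E * ((I B dualw * ((mA B)^-1)%:E)
  `^ (pB mu alpha p B - 1)%R))%E.
have pM0 := pM_gt0.
have maxl (x : R) : x <= Num.max x 0 /\ 0 <= Num.max x 0.
  by rewrite !le_max !lexx orbT.
split; split.
- move=> h; have [h1 h2] := in_B_masses_lty h; move: h.
  have [c c0 hc] := log_comparison h1 h2.
  (* From Y2 <= X + c and X <= q (Y1 + c), with q <= pM. *)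
  apply: (@bounded_transfer F1 F2 pM (pM * c + c)); first exact: ltW.
  move=> B hB; have [X [Y1 [Y2 [E1 E2 _ e1 e2]]]] := hc B hB.
  exists Y1, Y2; split => //; have /andP[q1 q2] := pB_in hB.
  set q := pB _ _ _ _ in q1 q2 e1.
  have q0 : 0 < q by exact: lt_trans ltr01 (lt_le_trans pm_gt1 q1).
  move: e1 e2; rewrite !ler_norml => /andP[e1 _] /andP[_ e2].
  have [y1 y0] := maxl Y1; set Y := Num.max Y1 0 in y1 y0 *.
  have : X / q <= Y + c by lra.
  rewrite ler_pdivrMr// => hX.
  have : (Y + c) * q <= (Y + c) * pM by rewrite ler_wpM2l// addr_ge0.
  lra.
- move=> h; have [h1 h2] := in_Bplus_masses_lty h; move: h.
  have [c c0 hc] := log_comparison h1 h2.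
  (* Here one divides by q >= 1, which does not increase a non-negative bound, so C = 1. *)
  apply: (@bounded_transfer F2 F1 1 (c + c)); first exact: ler01.
  move=> B hB; have [X [Y1 [Y2 [E1 E2 _ e1 e2]]]] := hc B hB.
  exists Y2, Y1; split => //; have /andP[q1 q2] := pB_in hB.
  set q := pB _ _ _ _ in q1 q2 e1.
  have q1' : 1 <= q by exact: le_trans (ltW pm_gt1) q1.
  have q0 : 0 < q by lra.
  move: e1 e2; rewrite !ler_norml => /andP[_ e1] /andP[e2 _].
  have [y1 y0] := maxl Y2; set Y := Num.max Y2 0 in y1 y0 *.
  have : X / q <= Y + c.
    rewrite ler_pdivrMr//; apply: (@le_trans _ _ (Y + c)); first lra.
    by rewrite ler_peMr// addr_ge0.
  lra.
- move=> h; have [h1 h2] := in_Bplus_masses_lty h; move: h.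
  have [c c0 hc] := log_comparison h1 h2.
  apply: (@bounded_transfer F2 F3 1 c); first exact: ler01.
  move=> B hB; have [X [Y1 [Y2 [_ E2 E3 _ e2]]]] := hc B hB.
  exists Y2, X; split => //; have [y1 y0] := maxl Y2.
  by move: e2; rewrite ler_norml => /andP[e2 _]; lra.
- move=> h; have [h1 h2] := in_Bplusplus_masses_lty h; move: h.
  have [c c0 hc] := log_comparison h1 h2.
  apply: (@bounded_transfer F3 F2 1 c); first exact: ler01.
  move=> B hB; have [X [Y1 [Y2 [_ E2 E3 _ e2]]]] := hc B hB.
  exists X, Y2; split => //; have [y1 y0] := maxl X.
  by move: e2; rewrite ler_norml => /andP[_ e2]; lra.
Qed.

End Weights.

Theorem mainTheorem10 (R : realType) (n : nat) (mu : {measure set Cn R n -> \bar R})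
  (alpha : R) (p : Cn R n -> R) :
  (0 < n)%N -> is_normalized_volume mu -> 0 < alpha -> Plog mu p ->
  forall w : Cn R n -> R, is_weight mu alpha w -> ~ ae_zero mu w ->
    (in_B mu alpha p w <-> in_Bplus mu alpha p w) /\
    (in_Bplus mu alpha p w <-> in_Bplusplus mu alpha p w).
Proof.
move=> n0 hmu alpha0 hp w hw w0.
have [pm pm1 hpm] := exponent_lower_bound n0 hmu hp.
have [pM hpM] := exponent_upper_bound n0 hmu alpha0 hp.
exact: (in_B_equivalences n0 hmu alpha0 hp hw w0 pm1 hpm hpM).
Qed.
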